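(* Let $G$ be a profinite group, and suppose that there exist an abelian profinite group $\mathfrak g$ (written additively) and a homeomorphism $\exp:\mathfrak g\to G$, with inverse $\log=\exp^{-1}$, such that the following two conditions hold: (i) for each $g\in G$, the map $\operatorname{Ad} g:\mathfrak g\to\mathfrak g$ given by $x\mapsto \log(g\exp(x)g^{-1})$ is a group automorphism of $\mathfrak g$; and (ii) the pullback map $\exp^*:\operatorname{Fun}(G)^G\to\operatorname{Fun}(\mathfrak g)^G$, $f\mapsto f\circ\exp$ (which is a bijection), commutes with convolution, i.e. $\exp^*(f_1*f_2)=\exp^*(f_1)*\exp^*(f_2)$ for all $f_1,f_2\in\operatorname{Fun}(G)^G$, the convolutions being taken in $G$ and in $\mathfrak g$ respectively. Then each $G$-orbit $\Omega\subset\mathfrak g^*$ is finite, and there is a bijection between the set $\mathfrak g^*/G$ of $G$-orbits in $\mathfrak g^*$ and the set $\widehat G$ such that the irreducible character $\chi$ of $G$ corresponding to an orbit $\Omega\subset\mathfrak g^*$ is given by $$\chi(\exp(x))=|\Omega|^{-1/2}\sum_{f\in\Omega}f(x)\qquad\text{for all }x\in\mathfrak g.$$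
   Context: For a profinite group $\Pi$, $\mu_\Pi$ is the Haar measure on $\Pi$ with $\mu_\Pi(\Pi)=1$, and the convolution of $L^2$-functions $f_1,f_2:\Pi\to\mathbb C$ is $(f_1*f_2)(\gamma)=\int_\Pi f_1(h)f_2(h^{-1}\gamma)\,d\mu_\Pi(h)$. $\operatorname{Fun}(\Pi)$ denotes the space of functions $\Pi\to\mathbb C$ that are bi-invariant with respect to some sufficiently small open subgroup of $\Pi$ (depending on the function). $\operatorname{Fun}(G)^G$ is the subspace of functions invariant under conjugation by $G$; $\operatorname{Fun}(\mathfrak g)^G$ is the subspace of functions in $\operatorname{Fun}(\mathfrak g)$ invariant under the action of $G$ on $\mathfrak g$ via $\operatorname{Ad}$. $\mathfrak g^*$ is the Pontryagin dual of $\mathfrak g$, i.e. the (discrete) group of continuous homomorphisms $\mathfrak g\to\mathbb C^\times$; $G$ acts on it through the action induced by $\operatorname{Ad}$ on $\mathfrak g$. $\widehat G$ is the set of isomorphism classes of continuous complex irreducible representations of $G$ (these are all finite dimensional), identified with the set of their characters. *)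

(* Defs.v *)
From HB Require Import structures.
From mathcomp Require Import all_boot all_order all_algebra finmap.
From mathcomp Require Import all_classical all_reals all_analysis.
From mathcomp Require Import complex.

Set Implicit Arguments.
Unset Strict Implicit.
Unset Printing Implicit Defensive.

Import Order.TTheory GRing.Theory Num.Theory.
Import numFieldNormedType.Exports.

Local Open Scope classical_set_scope.
Local Open Scope complex_scope.
Local Open Scope ring_scope.

HB.mixin Record isTopologicalGroup G of Topological G & Group G := {
  mulg_continuous : continuous (fun x : G * G => (x.1 * x.2)%g) ;
  invg_continuous : continuous (fun x : G => x^-1%g)
}.

#[short(type="topologicalGroupType")]
HB.structure Definition TopologicalGroup :=
  {G of Topological G & Group G & isTopologicalGroup G}.

(* The notions below are defined once, for multiplicative topological groups;
   an additive group A is fed to them as [GRing.to_multiplicative A]. *)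
HB.instance Definition _ (A : topologicalZmodType) :=
  Topological.copy (GRing.to_multiplicative A) A.
HB.instance Definition _ (A : topologicalZmodType) :=
  isTopologicalGroup.Build (GRing.to_multiplicative A)
    (@add_continuous A) (@opp_continuous A).

Definition profinite (T : topologicalType) : Prop :=
  [/\ compact [set: T], hausdorff_space T & totally_disconnected [set: T]].

(* [measurableType]s must be pointed; the base point 1 plays no role. *)
Definition pointed_group (G : topologicalGroupType) : Type := G.
HB.instance Definition _ (G : topologicalGroupType) :=
  Choice.on (pointed_group G).
HB.instance Definition _ (G : topologicalGroupType) :=
  isPointed.Build (pointed_group G) (1%g : G).

Notation borel G :=
  (g_sigma_algebraType (@open G : set (set (pointed_group G)))).

Section Functions.
Variables (R : realType) (G : topologicalGroupType).

Definition haar (mu : probability (borel G) R) : Prop :=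
  [/\ forall (g : G) (B : set G), measurable (B : set (borel G)) ->
        mu [set (g * x)%g | x in B] = mu B,
      forall B : set G, measurable (B : set (borel G)) ->
        mu B = ereal_inf [set mu U | U in [set U : set G | open U /\ B `<=` U]]
    & forall U : set G, open U ->
        mu U = ereal_sup [set mu K | K in [set K : set G | compact K /\ K `<=` U]]].

Definition Cintegral (mu : probability (borel G) R) (f : G -> R[i]) : R[i] :=
  (\int[mu]_x complex.Re (f x))%R +i* (\int[mu]_x complex.Im (f x))%R.

Definition convolution (mu : probability (borel G) R) (f1 f2 : G -> R[i]) :
    G -> R[i] :=
  fun y => Cintegral mu (fun h => f1 h * f2 (h^-1 * y)%g).

Definition open_subgroup (U : set G) : Prop :=
  [/\ open U, U 1%g & forall x y, U x -> U y -> U (x * y^-1)%g].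

Definition Fun : set (G -> R[i]) :=
  [set f | exists2 U, open_subgroup U &
     forall u v x, U u -> U v -> f (u * x * v)%g = f x].

Definition class_Fun : set (G -> R[i]) :=
  Fun `&` [set f | forall g x, f (g * x * g^-1)%g = f x].

End Functions.
Arguments Fun R G : clear implicits.
Arguments class_Fun R G : clear implicits.

Section Representations.
Variables (R : realType) (G : topologicalGroupType).

(* As for [mx_irreducible], matrices act on row vectors, and submodules are
   row spaces. [R[i]^o] carries the topology given by the complex modulus. *)
Record irrep := Irrep {
  irrep_deg : nat ;
  irrep_mx :> G -> 'M[R[i]]_irrep_deg ;
  irrep1 : irrep_mx 1%g = 1%:M ;
  irrepM : forall g h, irrep_mx (g * h)%g = irrep_mx g *m irrep_mx h ;
  irrep_continuous : continuous (irrep_mx : G -> 'M[R[i]^o]_irrep_deg) ;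
  irrep_deg_gt0 : (0 < irrep_deg)%N ;
  irrep_simple : forall U : 'M[R[i]]_irrep_deg,
    (forall g, (U *m irrep_mx g <= U)%MS) -> U = 0 \/ row_full U
}.

Definition irrep_iso (r s : irrep) : Prop :=
  exists2 B : 'M[R[i]]_(irrep_deg r, irrep_deg s),
    row_free B && row_full B & forall g, r g *m B = B *m s g.

Definition irrep_classes : set (set irrep) :=
  [set [set s | irrep_iso r s] | r in [set: irrep]].

Definition irrep_char (r : irrep) : G -> R[i] := fun g => \tr (r g).

End Representations.
Arguments irrep_classes R G : clear implicits.

(* Continuity into C^* is continuity into C, as C^* has the subspace topology. *)
Definition pontryagin_dual (R : realType) (A : topologicalZmodType) :
    set (A -> R[i]) :=
  [set f | [/\ continuous (f : A -> R[i]^o), forall x, f x != 0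
             & forall x y, f (x + y) = f x * f y]].
Arguments pontryagin_dual R A : clear implicits.

Section Adjoint.
Variables (R : realType) (G : groupType) (A : zmodType).
Variables (exp : A -> G) (log : G -> A).

Definition Ad (g : G) (x : A) : A := log (g * exp x * g^-1)%g.

Definition coadjoint (g : G) (f : A -> R[i]) : A -> R[i] :=
  fun x => f (Ad g^-1%g x).

Definition coadjoint_orbit (f : A -> R[i]) : set (A -> R[i]) :=
  [set coadjoint g f | g in [set: G]].

End Adjoint.

Definition dual_orbits (R : realType) (G : groupType) (A : topologicalZmodType)
    (exp : A -> G) (log : G -> A) : set (set (A -> R[i])) :=
  [set coadjoint_orbit exp log f | f in pontryagin_dual R A].
Arguments dual_orbits R {G A} exp log.

(* Main.v *)
Require Import Defs.
From HB Require Import structures.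
From mathcomp Require Import all_boot all_order all_algebra finmap.
From mathcomp Require Import all_classical all_reals all_analysis.
From mathcomp Require Import complex ring.

(** The class functions on G and the Ad-invariant functions on A form commutative
algebras under convolution, and by hypothesis [exp] identifies them. Such an
identification matches minimal idempotents. On G these are the functions
[d_r *: chi_r], for [r] an irreducible representation of degree [d_r] and
character [chi_r]; on A they are the sums of the characters in a coadjoint
orbit. So each [r] corresponds to exactly one orbit, whose sum is
[d_r *: (chi_r \o exp)]. Evaluating at [log 1], a fixed point of Ad, gives
[d_r ^ 2] for the number of elements of the orbit, whence the formula.

The matching needs little of the structure of the two algebras. Convolution by a
class function multiplies [chi_r] by a scalar (Schur's lemma,
[transform_class]), and convolution by an Ad-invariant function multiplies an
orbit sum by a scalar ([convolution_orbit_sum]). The product of an idempotent of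
G and an idempotent of A is then a multiple of each, and if it is nonzero they
coincide ([char_idempotent_orbit_sum]). For every idempotent on one side there
is one on the other with nonzero product, because every nonzero locally constant
function on a profinite group acts by a nonzero operator in some irreducible
representation ([irrep_detects]); on A these representations are characters
([dual_detects]).

Everything takes place among locally constant functions. Continuous
representations are locally constant because matrix groups have no small
subgroups ([representation_locally_constant]). On locally constant functions the
Haar integral is the only invariant mean ([invariant_mean_unique]), which gives
its invariance under conjugation and under Ad ([mean_precomp]). *)

Set Implicit Arguments.
Unset Strict Implicit.
Unset Printing Implicit Defensive.

Import Order.TTheory GRing.Theory Num.Theory.
Import numFieldNormedType.Exports.

Local Open Scope classical_set_scope.
Local Open Scope complex_scope.
Local Open Scope ring_scope.

(** * Locally constant functions and profinite spaces *)

Definition locally_constant (X : topologicalType) (T : Type) (f : X -> T) :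
    Prop :=
  forall x, \forall y \near x, f y = f x.

Section LocallyConstant.
Variable X : topologicalType.

Lemma locally_constant_cst (T : Type) (c : T) : locally_constant (fun _ : X => c).
Proof. by move=> x; exact: filterE. Qed.

Lemma locally_constant_comp (T S : Type) (h : T -> S) (f : X -> T) :
  locally_constant f -> locally_constant (fun x => h (f x)).
Proof. by move=> lf x; apply: filterS (lf x) => y ->. Qed.

Lemma locally_constant2 (T1 T2 S : Type) (h : T1 -> T2 -> S)
  (f1 : X -> T1) (f2 : X -> T2) :
  locally_constant f1 -> locally_constant f2 ->
  locally_constant (fun x => h (f1 x) (f2 x)).
Proof. by move=> l1 l2 x; apply: filterS2 (l1 x) (l2 x) => y -> ->. Qed.

Lemma locally_constant_precomp (Y : topologicalType) (T : Type) (h : Y -> X)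
  (f : X -> T) : continuous h -> locally_constant f ->
  locally_constant (fun y => f (h y)).
Proof. by move=> ch lf y; exact: (ch y _ (lf (h y))). Qed.

Lemma locally_constant_continuous (Y : topologicalType) (f : X -> Y) :
  locally_constant f -> continuous f.
Proof.
move=> lf x A /nbhs_singleton Afx.
by apply: filterS (lf x) => y /= ->.
Qed.

Lemma locally_constant_open (T : Type) (f : X -> T) (B : set T) :
  locally_constant f -> open (f @^-1` B).
Proof.
move=> lf; rewrite openE => x Bfx.
by apply: filterS (lf x) => y /= ->.
Qed.

Lemma clopen_locally_constant (B : set X) :
  clopen B -> locally_constant (fun x => B x).
Proof.
move=> [oB cB] x; have [Bx|nBx] := pselect (B x).
  apply: filterS (open_nbhs_nbhs (conj oB Bx)) => y By.
  by apply/propext.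
have := open_nbhs_nbhs (conj (closed_openC cB) nBx).
by apply: filterS => y nBy; apply/propext.
Qed.

(** The filter of the sets of values that contain a given finite set turns the
covering form of compactness into finiteness of the range. *)
Lemma locally_constant_finite_range (T : choiceType) (f : X -> T) :
  compact [set: X] -> locally_constant f -> finite_set (range f).
Proof.
move=> /compact_near_coveringP cX lf.
pose F : set_system (set T) := filter_from finite_set (fun D => [set E | D `<=` E]).
have FF : Filter F.
  apply: filter_from_filter; first by exists set0.
  move=> D E fD fE; exists (D `|` E); first by rewrite finite_setU.
  by move=> B /= DEB; split=> x ?; apply: DEB; [left|right].
have [|D fD FD] := cX _ F (fun D x => D (f x)) FF.
  move=> x _; exists ([set y | f y = f x], [set E | [set f x] `<=` E]) => /=.
    by split; [exact: lf|exists [set f x]].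
  by move=> [y E] /= [-> ]; apply.
apply: sub_finite_set fD => _ [x _ <-].
by apply: (FD D).
Qed.

(** The tube lemma: over a compact parameter space, the finitely many
neighbourhoods needed for all parameters have a common part. *)
Lemma locally_constant_curry (K : topologicalType) (T : Type)
  (f : X -> K -> T) : compact [set: K] ->
  locally_constant (fun p : X * K => f p.1 p.2) -> locally_constant f.
Proof.
move=> /compact_near_coveringP cK lf x.
have := cK _ (nbhs x) (fun x' k => f x' k = f x k) _.
have h k : [set: K] k -> \forall k' \near k & x' \near x, f x' k' = f x k'.
  move=> _.
  have [[U V] /= [Ux Vk] UV] := lf (x, k).
  exists (V, U) => //= -[k' x'] [/= Vk' Ux'].
  have /= -> := UV (x', k') (conj Ux' Vk').
  by have /= -> := UV (x, k') (conj (nbhs_singleton Ux) Vk').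
move=> /(_ _ h); apply: filterS => x' e.
by apply/funext => k; exact: e.
Qed.

End LocallyConstant.

(** Normality separates two closed halves of this intersection by open sets;
by compactness a single clopen neighbourhood already lies in their union, and
its trace on one of them is again clopen, so the other half is empty. *)
Lemma quasicomponent_connected (X : topologicalType) (x : X) :
  compact [set: X] -> hausdorff_space X ->
  connected [set y | forall C, clopen C -> C x -> C y].
Proof.
move=> cX hX; set Q := [set y | _].
have cQ : closed Q.
  rewrite (_ : Q = \bigcap_(C in [set C | clopen C /\ C x]) C).
    by apply: closed_bigI => C [[_ cC] _].
  apply/seteqP; split=> y Qy; first by move=> C [? ?]; exact: Qy.
  by move=> C ? ?; exact: Qy.
have Qx : Q x by [].
(* Compactness of the complement of O: the clopen neighbourhoods of x form a
   filter base, and each point outside Q is missed by one of them. *)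
have QO (O : set X) : open O -> Q `<=` O ->
    exists C, [/\ clopen C, C x & C `<=` O].
  move=> oO QO.
  have cO : compact (~` O).
    exact: subclosed_compact (open_closedC oO) cX (@subsetT _ _).
  pose F := filter_from [set C : set X | clopen C /\ C x]
    (fun C => [set D | D `<=` C]).
  have FF : Filter F.
    apply: filter_from_filter; first by exists setT; split=> //; exact: clopenT.
    move=> D E [cD Dx] [cE Ex]; exists (D `&` E); first by split=> //; exact: clopenI.
    by move=> B /= DEB; split=> y /DEB [].
  have [|C [cC Cx] CO] := iffLR (compact_near_coveringP _) cO _ F
    (fun D y => ~ D y) FF.
    move=> y nOy; have [C [cC Cx nCy]] : exists C, [/\ clopen C, C x & ~ C y].
      apply: contrapT => h; apply: nOy; apply: QO => C cC Cx.
      by apply: contrapT => nCy; apply: h; exists C.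
    exists (~` C, [set D | D `<=` C]); first split; last by case=> z D [/= nCz DC] /DC.
    - by apply: open_nbhs_nbhs; split=> //; apply: closed_openC; case: cC.
    - by exists C.
  exists C; split=> // y Cy; apply: contrapT => nOy.
  exact: (CO C _ y nOy).
have split_Q (E E' : set X) : closed E -> closed E' -> E `&` E' = set0 ->
    Q = E `|` E' -> E x -> Q `<=` E.
  move=> cE cE' EE' QEE' Ex.
  have nE : set_nbhs E (~` E').
    apply/set_nbhsP; exists (~` E'); split=> //; first exact: closed_openC.
    by move=> y Ey E'y; have : (E `&` E') y by []; rewrite EE'.
  have [W /set_nbhsP [W' [oW' EW' W'W]] cWE] := compact_normal hX cX cE nE.
  have [|y|C [cC Cx CO]] := QO (W' `|` ~` closure W).
  - by apply: openU => //; apply: closed_openC; exact: closed_closure.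
  - rewrite QEE' => -[/EW' ?|E'y]; [by left|right=> /cWE]; exact.
  (* an open trace equal to a closed trace, hence clopen *)
  have CW : C `&` W' = C `&` closure W.
    apply/seteqP; split=> y [Cy Wy]; split=> //.
      by apply: subset_closure; exact: W'W.
    by case: (CO y Cy).
  have cCW : clopen (C `&` W').
    split; first by apply: openI => //; case: cC.
    by rewrite CW; apply: closedI; [case: cC|exact: closed_closure].
  move=> y Qy; have : (C `&` W') y by apply: Qy => //; split=> //; exact: EW'.
  rewrite CW => -[_ /cWE nE'y].
  by move: Qy; rewrite QEE' => -[].
move=> B [b Bb] [U oU BU] [V cV BV].
have cB : closed B by rewrite BV; exact: closedI.
have cB' : closed (Q `&` ~` U) by apply: closedI => //; exact: open_closedC.
have BB' : B `&` (Q `&` ~` U) = set0.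
  by rewrite BU setIACA setICr setI0.
have QBB' : Q = B `|` (Q `&` ~` U) by rewrite BU -setIUr setUCr setIT.
have [Bx|nBx] := pselect (B x).
  apply/seteqP; split; first by rewrite BU => y [].
  exact: (split_Q B (Q `&` ~` U)).
have B'x : (Q `&` ~` U) x.
  by split=> // Ux; apply: nBx; rewrite BU.
have QB' : Q `<=` Q `&` ~` U.
  by apply: (split_Q _ B cB' cB _ _ B'x); [rewrite setIC|rewrite setUC].
have Qb : Q b by move: Bb; rewrite BU => -[].
by have [_] := QB' _ Qb; move: Bb; rewrite BU => -[].
Qed.

(** Total disconnectedness makes the connected quasicomponent a point. *)
Lemma profinite_clopen_nbhs (X : topologicalType) (x : X) (O : set X) :
  profinite X -> nbhs x O -> exists C, [/\ clopen C, C x & C `<=` O].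
Proof.
move=> [cX hX tX] Ox.
have zX : zero_dimensional X.
  move=> a b ab; apply: contrapT => h.
  suff : connected_component [set: X] a b by rewrite tX//= => ba; move: ab; rewrite ba eqxx.
  have Qc := quasicomponent_connected (x := a) cX hX.
  apply: (connected_component_max _ (@subsetT _ _) Qc) => //.
  by move=> C cC Ca; apply: contrapT => nCb; apply: h; exists C.
have [C [Cx cC] CO] := zero_dimensional_cvg hX zX cX Ox.
by exists C.
Qed.

(** * Locally constant functions on profinite groups *)

Lemma continuous_comp_fun (X Y Z : topologicalType) (f : X -> Y) (g : Y -> Z) :
  continuous f -> continuous g -> continuous (fun x => g (f x)).
Proof. by move=> cf cg x; exact: (continuous_comp (cf x) (cg (f x))). Qed.

Lemma continuous_fst (X Y : topologicalType) : continuous (@fst X Y).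
Proof. by move=> x; exact: cvg_fst. Qed.

Lemma continuous_snd (X Y : topologicalType) : continuous (@snd X Y).
Proof. by move=> x; exact: cvg_snd. Qed.

Section TopologicalGroup.
Variable G : topologicalGroupType.

Lemma continuous_mulg (X : topologicalType) (f g : X -> G) :
  continuous f -> continuous g -> continuous (fun x => (f x * g x)%g).
Proof.
move=> cf cg x.
exact: (continuous_comp (cvg_pair (cf x) (cg x)) (@mulg_continuous G (f x, g x))).
Qed.

Lemma continuous_invg (X : topologicalType) (f : X -> G) :
  continuous f -> continuous (fun x => (f x)^-1%g).
Proof. by move=> cf x; exact: (continuous_comp (cf x) (@invg_continuous G (f x))). Qed.

Lemma continuous_mulgl (g : G) : continuous (fun x => (g * x)%g).
Proof. by apply: continuous_mulg; [exact: cst_continuous|move=> x]. Qed.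

Lemma continuous_conjg (g : G) : continuous (fun x => (g * x * g^-1)%g).
Proof.
apply: continuous_mulg; last exact: cst_continuous.
exact: continuous_mulgl.
Qed.

Lemma locally_constant_invg (T : Type) (f : G -> T) :
  locally_constant f -> locally_constant (fun g => f g^-1%g).
Proof. by apply: locally_constant_precomp; exact: invg_continuous. Qed.

Lemma locally_constant_right_invariant (T : Type) (N : set G) (f : G -> T) :
  open N -> N 1%g -> (forall x u, N u -> f (x * u)%g = f x) ->
  locally_constant f.
Proof.
move=> oN N1 fN x; have : nbhs x [set y | N (x^-1 * y)%g].
  apply: open_nbhs_nbhs; split; last by rewrite /= mulVg.
  by apply: open_comp => // y _; exact: continuous_mulgl.
by apply: filterS => y /= Ny; rewrite -[y](mulVKg x); exact: fN.
Qed.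

Lemma convolution_locally_constant (S : pzRingType) (f f' : G -> S) y :
  locally_constant f -> locally_constant f' ->
  locally_constant (fun h => f h * f' (h^-1 * y)%g).
Proof.
move=> lf lf'; apply: (locally_constant2 ( *%R)) => //.
apply: (locally_constant_precomp (h := fun h => (h^-1 * y)%g)) lf'.
by apply: continuous_mulg; [exact: invg_continuous|exact: cst_continuous].
Qed.

Section OpenSubgroup.
Variables (N : set G) (oN : open_subgroup N).

Lemma open_subgroup1 : N 1%g. Proof. by case: oN. Qed.

Lemma open_subgroupV x : N x -> N x^-1%g.
Proof.
by have [_ N1 NB] := oN; move=> Nx; rewrite -(mul1g x^-1%g); exact: NB.
Qed.

Lemma open_subgroupM x y : N x -> N y -> N (x * y)%g.
Proof.
have [_ _ NB] := oN; move=> Nx Ny.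
by rewrite -(invgK y); apply: NB => //; exact: open_subgroupV.
Qed.

Lemma open_subgroup_locally_constant : locally_constant (fun x => N x).
Proof.
have [oN' N1 NB] := oN.
apply: (locally_constant_right_invariant oN' N1) => x u Nu.
apply/propext; split=> Nx; last exact: open_subgroupM.
by rewrite -(mulgK u x); exact: NB.
Qed.

End OpenSubgroup.

(** For locally constant [f] on a compact group, this is an open normal
subgroup, and [f] factors through the quotient by it. This is how open normal
subgroups are produced below. *)
Definition periods (T : Type) (f : G -> T) : set G :=
  [set g | forall x y, f (x * g * y)%g = f (x * y)%g].

Section Periods.
Variables (T : Type) (f : G -> T).

(** The tube lemma, applied to the family of all two-sided translates of [f]. *)
Lemma periods_open : compact [set: G] -> locally_constant f -> open (periods f).
Proof.
move=> cG lf.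
have l : locally_constant (fun (g : G) (p : G * G) => f (p.1 * g * p.2)%g).
  apply: locally_constant_curry.
    by rewrite -setXTT; exact: compact_setX.
  apply: (locally_constant_precomp
    (h := fun q : G * (G * G) => (q.2.1 * q.1 * q.2.2)%g)) lf.
  apply: continuous_mulg; first apply: continuous_mulg.
  - exact: continuous_comp_fun (@continuous_snd _ _) (@continuous_fst _ _).
  - exact: continuous_fst.
  - exact: continuous_comp_fun (@continuous_snd _ _) (@continuous_snd _ _).
have -> : periods f = (fun (g : G) (p : G * G) => f (p.1 * g * p.2)%g) @^-1`
    [set fun p => f (p.1 * 1 * p.2)%g].
  apply/seteqP; split=> g.
    by move=> fg; apply/funext => -[x y] /=; rewrite fg mulg1.
  by move=> e x y; have /= := congr1 (fun h => h (x, y)) e; rewrite mulg1.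
exact: locally_constant_open.
Qed.

Lemma periods1 : periods f 1%g.
Proof. by move=> x y; rewrite mulg1. Qed.

Lemma periodsM g h : periods f g -> periods f h -> periods f (g * h)%g.
Proof. by move=> fg fh x y; rewrite mulgA fh fg. Qed.

Lemma periodsV g : periods f g -> periods f g^-1%g.
Proof. by move=> fg x y; have := fg (x * g^-1)%g y; rewrite mulgVK => ->. Qed.

Lemma periodsJ x g : periods f g -> periods f (x * g * x^-1)%g.
Proof.
move=> fg a b.
have -> : (a * (x * g * x^-1) * b = (a * x) * g * (x^-1 * b))%g by rewrite !mulgA.
by rewrite fg -mulgA mulVKg.
Qed.

End Periods.
End TopologicalGroup.

Lemma locally_constant_fibres (X : topologicalType) (T : choiceType) (q : X -> T) :
  compact [set: X] -> locally_constant q ->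
  exists n (s : 'I_n -> X) (k : X -> 'I_n),
    [/\ forall x, q (s (k x)) = q x, forall i, k (s i) = i
      & forall x y, q x = q y -> k x = k y].
Proof.
move=> cX lq; have fq := locally_constant_finite_range cX lq.
pose r : seq T := fset_set (range q).
have rq x : q x \in r.
  by rewrite /r in_fset_set// inE; exists x.
have ex (i : 'I_(size r)) : {x | q x = tnth (in_tuple r) i}.
  have : tnth (in_tuple r) i \in r by exact: mem_tnth.
  rewrite /r in_fset_set// inE => h; apply: cid.
  by case: h => x _ <-; exists x.
have ltr x : (index (q x) r < size r)%N by rewrite index_mem.
exists (size r), (fun i => sval (ex i)), (fun x => Ordinal (ltr x)); split.
- move=> x; case: (ex _) => y /= ->.
  by rewrite (tnth_nth (q x))/= nth_index.
- move=> i; case: (ex i) => y /= qy; apply/val_inj => /=.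
  by rewrite qy (tnth_nth (q y))/= index_uniq// fset_uniq.
- by move=> x y qxy; apply/val_inj; rewrite /= qxy.
Qed.

Section FiniteQuotient.
Variables (G : topologicalGroupType) (cG : compact [set: G]).

(** [k] numbers the cosets and [s] picks representatives. *)
Lemma finite_cosets (N : set G) : open_subgroup N ->
  exists n (s : 'I_n -> G) (k : G -> 'I_n),
    forall x i, k x = i <-> N ((s i)^-1 * x)%g.
Proof.
move=> oN; have NV := open_subgroupV oN; have NM := open_subgroupM oN.
pose q (x : G) : set G := [set y | N (x^-1 * y)%g].
have qP x y : q x = q y <-> N (x^-1 * y)%g.
  split=> [qxy|Nxy].
    have : q y y by rewrite /q/= mulVg; exact: open_subgroup1.
    by rewrite -qxy.
  apply/seteqP; split=> z /= Nz.
    by have := NM _ _ (NV _ Nxy) Nz; rewrite invgM invgK mulgA mulgK.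
  by have := NM _ _ Nxy Nz; rewrite mulgA mulgK.
have lq : locally_constant q.
  have [oN' N1 _] := oN.
  apply: (locally_constant_right_invariant oN' N1) => x u Nu.
  by apply/esym/qP; rewrite mulKg.
have [n [s [k [qsk ks kq]]]] := locally_constant_fibres cG lq.
exists n, s, k => x i; split; first by move=> <-; apply/qP.
by move=> /qP/kq <-; rewrite ks.
Qed.

Lemma periods_open_subgroup (T : Type) (f : G -> T) :
  locally_constant f -> open_subgroup (periods f).
Proof.
move=> lf; split; [exact: periods_open|exact: periods1|].
by move=> x y fx fy; apply: periodsM => //; exact: periodsV.
Qed.

Lemma locally_constant_Fun (R : realType) (f : G -> R[i]) :
  locally_constant f -> Defs.Fun R G f.
Proof.
move=> lf; exists (periods f); first exact: periods_open_subgroup.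
move=> u v x fu fv; rewrite -(mulg1 (u * x * v)%g) fv mulg1.
by have := fu 1%g x; rewrite !mul1g.
Qed.

End FiniteQuotient.

(** * Continuous representations are locally constant *)

Lemma geometric_bound_eq0 (R : realType) (z c q : R[i]) :
  0 <= c -> 0 <= q < 1 -> (forall m, `|z| <= q ^+ m * c) -> z = 0.
Proof.
move=> c0 /andP[q0 q1] zm.
have [a a0 qa] : exists2 a : R, 0 <= a < 1 & q = a%:C.
  move: q0 q1; rewrite lecE ltcE /= => /andP[/eqP iq rq] /andP[_ rq1].
  exists (complex.Re q); first by rewrite rq rq1.
  by case: q iq {rq rq1 zm} => ? ? /= ->.
have [b b0 cb] : exists2 b : R, 0 <= b & c = b%:C.
  move: c0; rewrite lecE /= => /andP[/eqP ic rc].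
  exists (complex.Re c) => //.
  by case: c ic {rc zm} => ? ? /= ->.
move: zm; rewrite qa cb normc_def; set r := Num.sqrt _ => zm.
apply/eqP; rewrite -normr_eq0 normc_def -/r.
suff -> : r = 0 by [].
apply/eqP; rewrite eq_le sqrtr_ge0 andbT.
have cv : (fun m => a ^+ m * b) @ \oo --> (0 * b : R).
  by apply: cvgMl; apply: cvg_expr; rewrite ger0_norm; case/andP: a0.
rewrite mul0r in cv; rewrite -(cvg_lim _ cv)//.
apply: limr_ge; first by apply/cvg_ex; exists 0.
by near=> m; rewrite -lecR rmorphM rmorphXn; exact: zm.
Unshelve. all: end_near. Qed.

(** Matrix groups have no small subgroups. If the entries of [X = rho g - 1] are
bounded by a small [d] for all [g] in a subgroup, then the identity
[2 X = (rho (g * g) - 1) - X^2] improves the bound to [3/4 d]; iterating, [rho]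
is trivial on the subgroup. In a profinite group every neighbourhood of 1
contains an open subgroup, so the kernel of [rho] is open. *)
Lemma representation_locally_constant (R : realType) (G : topologicalGroupType)
  n (rho : G -> 'M[R[i]]_n) :
  profinite G -> rho 1%g = 1%:M ->
  (forall g h, rho (g * h)%g = rho g *m rho h) ->
  (forall i j, continuous (fun g => rho g i j : R[i]^o)) ->
  locally_constant rho.
Proof.
move=> pG rho1 rhoM crho; have [cG _ _] := pG.
(* small enough for n e <= 1/2, so that X^2 contributes at most d / 2 *)
pose e : R[i] := (n.+1%:R * 2)^-1.
have e0 : 0 < e by rewrite invr_gt0 mulr_gt0// ltr0Sn.
have ne : n%:R * e <= 2^-1.
  rewrite /e invfM mulrA ler_piMl ?invr_ge0//.
  by rewrite ler_pdivrMr ?ltr0Sn// mul1r ler_nat.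
have We : nbhs (1%g : G) [set g | forall i j, `|rho g i j - rho 1%g i j| < e].
  apply: filter_forall => i; apply: filter_forall => j.
  exact: cvgr_distC_lt (crho i j 1%g) _ e0.
have [C [cC C1 CW]] := profinite_clopen_nbhs pG We.
pose N := periods (fun x => C x).
have NC g : N g -> C g by move=> /(_ 1%g 1%g); rewrite !mulg1 mul1g => ->.
have [oN N1 _] : open_subgroup N.
  exact: (periods_open_subgroup cG (clopen_locally_constant cC)).
have small g i j : N g -> `|(rho g - 1%:M) i j| <= e.
  by move=> /NC/CW/(_ i j)/ltW; rewrite rho1 !mxE.
have bound m g i j : N g -> `|(rho g - 1%:M) i j| <= (3 / 4) ^+ m * e.
  elim: m g i j => [|m IH] g i j Ng.
    by rewrite expr0 mul1r small.
  set X := rho g - 1%:M; set d := _ ^+ m * e in IH.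
  have Xe k l : `|X k l| <= e by exact: small.
  have eX : X *+ 2 = (rho (g * g)%g - 1%:M) - X *m X.
    rewrite rhoM /X mulmxBl mulmxBr mulmx1 mul1mx mulr2n.
    move: (rho g *m rho g) => S.
    by apply/matrixP => k l; rewrite !mxE; ring.
  have : `|X i j *+ 2| <= d + d / 2.
    have -> : X i j *+ 2 = (X *+ 2) i j by rewrite !mulr2n [RHS]mxE.
    rewrite eX mxE [X in _ + X]mxE.
    apply: (le_trans (ler_normB _ _)); apply: lerD; first exact: IH (periodsM Ng Ng).
    rewrite mxE; apply: (le_trans (ler_norm_sum _ _ _)).
    apply: (@le_trans _ _ (\sum_(k < n) d * e)).
      by apply: ler_sum => k _; rewrite normrM ler_pM//; exact: IH.
    rewrite sumr_const card_ord -[leLHS]mulr_natl mulrCA ler_wpM2l//.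
    by rewrite mulr_ge0 ?exprn_ge0 ?divr_ge0// ltW.
  rewrite -[X in `|X|]mulr_natr normrM normr_nat -ler_pdivlMr//.
  move=> /le_trans; apply; rewrite exprS -mulrA -/d.
  by rewrite le_eqVlt; apply/orP; left; apply/eqP; field.
have rhoN g : N g -> rho g = 1%:M.
  move=> Ng; apply/eqP; rewrite -subr_eq0; apply/eqP/matrixP => i j.
  rewrite [RHS]mxE; apply: (@geometric_bound_eq0 _ _ e (3 / 4)).
  - exact: ltW.
  - by rewrite divr_ge0//= ltr_pdivrMr// mul1r ltr_nat.
  - by move=> m; exact: bound.
apply: (locally_constant_right_invariant oN N1) => x u /rhoN Nu.
by rewrite rhoM Nu mulmx1.
Qed.

(** * Invariant means on locally constant functions *)

(** The four properties of the Haar integral through which it is used. On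
locally constant functions they determine it. *)
Record invariant_mean (R : realType) (G : topologicalGroupType)
    (I : (G -> R[i]) -> R[i]) : Prop := InvariantMean {
  meanD : forall f g, locally_constant f -> locally_constant g ->
    I (fun x => f x + g x) = I f + I g ;
  meanZ : forall c f, locally_constant f -> I (fun x => c * f x) = c * I f ;
  mean1 : I (fun=> 1) = 1 ;
  mean_mulgl : forall a f, locally_constant f -> I (fun x => f (a * x)%g) = I f
}.

Section HaarMean.
Variables (R : realType) (G : topologicalGroupType) (cG : compact [set: G]).
Variables (mu : probability (borel G) R) (mu_haar : haar mu).

Lemma open_measurable_borel (B : set G) : open B -> measurable (B : set (borel G)).
Proof. by move=> oB; exact: sub_sigma_algebra. Qed.

Lemma locally_constant_measurable (f : G -> R) :
  locally_constant f -> measurable_fun [set: borel G] f.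
Proof.
move=> lf _ B _; rewrite setTI; apply: open_measurable_borel.
exact: locally_constant_open.
Qed.

Lemma locally_constant_integrable (f : G -> R) :
  locally_constant f -> mu.-integrable [set: borel G] (EFin \o f).
Proof.
move=> lf; apply: measurable_bounded_integrable => //.
- by rewrite (le_lt_trans (probability_le1 mu _))// ltry.
- exact: locally_constant_measurable.
- have cf : {within [set: G], continuous f}.
    by apply/continuous_subspaceT => x; exact: locally_constant_continuous.
  have /compact_bounded[M [_ Mf]] := continuous_compact cf cG.
  exists M; split; first exact: num_real.
  by move=> x Mx y _; apply: Mf => //; exists y.
Qed.

Lemma mulgl_measurable (a : G) :
  measurable_fun [set: borel G] ((fun x => a * x)%g : borel G -> borel G).
Proof.
have h := @measurability _ _ (borel G) (borel G) setT (fun x => (a * x)%g)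
  (@open G : set (set (pointed_group G))) erefl.
apply: h => _ [B oB <-]; rewrite setTI.
apply: open_measurable_borel.
by apply: open_comp => // x _; exact: continuous_mulgl.
Qed.

(** The image of the Haar measure under a left translation is the measure
itself. *)
Lemma Rintegral_mulgl (a : G) (f : G -> R) : locally_constant f ->
  \int[mu]_x f (a * x)%g = \int[mu]_x f x.
Proof.
move=> lf; rewrite /Rintegral; congr fine.
have ma := mulgl_measurable a.
have lfa : locally_constant (fun x => f (a * x)%g).
  exact: locally_constant_precomp (@continuous_mulgl _ a) lf.
have := @integral_pushforward _ _ _ _ R _ ma mu setT (EFin \o f).
rewrite preimage_setT => /(_ _ (locally_constant_integrable lfa)) <- //; last first.
  apply/measurable_realfun.measurable_EFinP; exact: locally_constant_measurable.
apply: eq_measure_integral => B mB _ /=.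
have [muE _ _] := mu_haar.
rewrite /pushforward -[RHS](muE a^-1%g)//; congr (mu _).
apply/seteqP; split=> x.
  by move=> Bx; exists (a * x)%g => //; rewrite mulKg.
by move=> [y By <-]; rewrite /= mulVKg.
Qed.

Lemma haar_invariant_mean : invariant_mean (Cintegral mu).
Proof.
have lRe (f : G -> R[i]) : locally_constant f -> locally_constant (fun x => complex.Re (f x)).
  exact: locally_constant_comp.
have lIm (f : G -> R[i]) : locally_constant f -> locally_constant (fun x => complex.Im (f x)).
  exact: locally_constant_comp.
split.
- move=> f g lf lg; rewrite /Cintegral.
  under eq_Rintegral do rewrite raddfD/=.
  under [X in _ +i* X]eq_Rintegral do rewrite raddfD/=.
  by rewrite !RintegralD//; apply: locally_constant_integrable; auto.
- move=> c f lf; rewrite /Cintegral.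
  have ReM (x y : R[i]) : complex.Re (x * y) =
      complex.Re x * complex.Re y - complex.Im x * complex.Im y.
    by case: x y => [? ?] [? ?].
  have ImM (x y : R[i]) : complex.Im (x * y) =
      complex.Re x * complex.Im y + complex.Im x * complex.Re y.
    by case: x y => [? ?] [? ?].
  have iZ (a : R) (g : G -> R) : locally_constant g ->
      mu.-integrable [set: borel G] (EFin \o (fun x => a * g x)).
    move=> lg; apply: locally_constant_integrable.
    exact: (locally_constant_comp ( *%R a)).
  under eq_Rintegral do rewrite ReM.
  under [X in _ +i* X]eq_Rintegral do rewrite ImM.
  rewrite RintegralB// ?RintegralD//; try by apply: iZ; auto.
  rewrite !RintegralZl//; try by apply: locally_constant_integrable; auto.
  by case: c => a b; rewrite /= /GRing.mul/=.
- rewrite /Cintegral /= !Rintegral_cst//.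
  rewrite mul0r mul1r; congr (_ +i* _).
  exact: (congr1 fine (probability_setT mu)).
- by move=> a f lf; rewrite /Cintegral !(Rintegral_mulgl a (f := fun x => _ (f x)))//; auto.
Qed.

End HaarMean.

Section MeanTheory.
Variables (R : realType) (G : topologicalGroupType) (cG : compact [set: G]).
Variables (I : (G -> R[i]) -> R[i]) (I_mean : invariant_mean I).

Lemma mean_cst c : I (fun=> c) = c.
Proof.
rewrite -[RHS]mulr1 -[X in _ * X](mean1 I_mean).
rewrite -(meanZ I_mean); last exact: locally_constant_cst.
by congr I; apply/funext => x; rewrite mulr1.
Qed.

Lemma locally_constant_sum (J : Type) (r : seq J) (P : pred J) (F : J -> G -> R[i]) :
  (forall j, locally_constant (F j)) ->
  locally_constant (fun x => \sum_(j <- r | P j) F j x).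
Proof.
move=> lF; elim: r => [|j r IH].
  rewrite (_ : (fun _ => _) = (fun=> 0)); first exact: locally_constant_cst.
  by apply/funext => x; rewrite big_nil.
rewrite (_ : (fun _ => _) =
    (fun x => (if P j then F j x else 0) + \sum_(i <- r | P i) F i x)).
  by apply: locally_constant2 => //; case: (P j) => //; exact: locally_constant_cst.
by apply/funext => x; rewrite big_cons; case: (P j); rewrite ?add0r.
Qed.

Lemma mean_sum (J : Type) (r : seq J) (P : pred J) (F : J -> G -> R[i]) :
  (forall j, locally_constant (F j)) ->
  I (fun x => \sum_(j <- r | P j) F j x) = \sum_(j <- r | P j) I (F j).
Proof.
move=> lF; elim: r => [|j r IH].
  by rewrite big_nil -[RHS]mean_cst; congr I; apply/funext => x; rewrite big_nil.
rewrite big_cons -IH; case: ifPn => Pj.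
  rewrite -(meanD I_mean)//; last exact: locally_constant_sum.
  by congr I; apply/funext => x; rewrite big_cons Pj.
by congr I; apply/funext => x; rewrite big_cons (negPf Pj).
Qed.

Lemma meanZr c f : locally_constant f -> I (fun x => f x * c) = I f * c.
Proof.
move=> lf; rewrite mulrC -(meanZ I_mean)//.
by congr I; apply/funext => x; rewrite mulrC.
Qed.

(** A function invariant under [N] is a combination of the indicators of the
cosets of [N], which are translates of one another and hence have the same
mean. *)
Lemma mean_cosets (N : set G) n (s : 'I_n -> G) (k : G -> 'I_n) :
  open_subgroup N -> (forall x i, k x = i <-> N ((s i)^-1 * x)%g) ->
  n%:R * I (fun x => `[< N x >]%:R) = 1 /\
  forall f, (forall x u, N u -> f (x * u)%g = f x) ->
    I f = (\sum_i f (s i)) * I (fun x => `[< N x >]%:R).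
Proof.
move=> oN kN; set v := I _.
have lN : locally_constant (fun x => `[< N x >]%:R : R[i]).
  exact: (locally_constant_comp (fun P => `[< P >]%:R)
    (open_subgroup_locally_constant oN)).
have meanE f : (forall x u, N u -> f (x * u)%g = f x) ->
    I f = (\sum_i f (s i)) * v.
  move=> fN.
  have fE : f = fun x => \sum_i f (s i) * `[< N ((s i)^-1 * x)%g >]%:R.
    apply/funext => x; rewrite (bigD1 (k x))//= big1 => [|i ik].
      have Nk : N ((s (k x))^-1 * x)%g by exact/kN.
      by rewrite asboolT// mulr1 addr0 -(fN (s (k x)) _ Nk) mulVKg.
    rewrite asboolF ?mulr0// => /kN kxi.
    by rewrite kxi eqxx in ik.
  have lNs i : locally_constant (fun x => `[< N ((s i)^-1 * x)%g >]%:R : R[i]).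
    exact: locally_constant_precomp (@continuous_mulgl _ _) lN.
  rewrite [in LHS]fE mean_sum => [|i]; last exact: (locally_constant_comp ( *%R (f (s i)))).
  rewrite mulr_suml; apply: eq_bigr => i _.
  by rewrite (meanZ I_mean)// (mean_mulgl I_mean (s i)^-1%g lN).
split=> //.
have := meanE (fun=> 1) (fun _ _ _ => erefl).
by rewrite (mean1 I_mean) sumr_const card_ord.
Qed.

End MeanTheory.

(** Both means average over the cosets of the group of periods of [f]. *)
Lemma invariant_mean_unique (R : realType) (G : topologicalGroupType)
    (I J : (G -> R[i]) -> R[i]) f : compact [set: G] ->
  invariant_mean I -> invariant_mean J -> locally_constant f -> I f = J f.
Proof.
move=> cG mI mJ lf.
have oN := periods_open_subgroup cG lf.
have [n [s [k kN]]] := finite_cosets cG oN.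
have [I1 ->] := mean_cosets mI oN kN; last first.
  by move=> x u fu; rewrite -(mulg1 (x * u)%g) fu mulg1.
have [J1 ->] := mean_cosets mJ oN kN; last first.
  by move=> x u fu; rewrite -(mulg1 (x * u)%g) fu mulg1.
have n0 : n%:R != 0 :> R[i].
  by apply/eqP => n0; move/eqP: I1; rewrite n0 mul0r eq_sym oner_eq0.
by congr (_ * _); apply: (mulfI n0); rewrite I1 J1.
Qed.

(** If [alpha] normalizes the left translations, [f |-> I (f \o alpha)] is
another invariant mean. Conjugations and the maps Ad g are such [alpha]. *)
Lemma mean_precomp (R : realType) (G : topologicalGroupType)
    (I : (G -> R[i]) -> R[i]) (alpha beta : G -> G) f :
  compact [set: G] -> invariant_mean I -> continuous alpha ->
  (forall a h, a * alpha h = alpha (beta a * h))%g ->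
  locally_constant f -> I (fun x => f (alpha x)) = I f.
Proof.
move=> cG mI ca ab lf.
have l (F : G -> R[i]) : locally_constant F -> locally_constant (F \o alpha).
  exact: locally_constant_precomp.
apply: (invariant_mean_unique (I := fun F => I (F \o alpha)) cG) => //; split.
- by move=> F H lF lH; rewrite -(meanD mI (l _ lF) (l _ lH)).
- by move=> c F lF; rewrite -(meanZ mI c (l _ lF)).
- exact: mean1 mI.
- move=> a F lF; rewrite -(mean_mulgl mI (beta a) (l _ lF)).
  by congr I; apply/funext => x /=; rewrite ab.
Qed.

Section MatrixMean.
Variables (R : realType) (G : topologicalGroupType) (cG : compact [set: G]).
Variables (I : (G -> R[i]) -> R[i]) (I_mean : invariant_mean I).

Definition mxmean m n (F : G -> 'M[R[i]]_(m, n)) : 'M[R[i]]_(m, n) :=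
  \matrix_(i, j) I (fun g => F g i j).

Section MatrixMeanTheory.
Variables (m n : nat) (F : G -> 'M[R[i]]_(m, n)).
Hypothesis lF : locally_constant F.

Let lFij i j : locally_constant (fun g => F g i j).
Proof. exact: (locally_constant_comp (fun M : 'M[R[i]]_(_, _) => M i j)). Qed.

Lemma mulmx_mxmean p (A : 'M[R[i]]_(p, m)) :
  A *m mxmean F = mxmean (fun g => A *m F g).
Proof.
apply/matrixP => i j; rewrite !mxE.
under [in RHS]eq_fun do rewrite mxE.
rewrite (mean_sum I_mean); last by move=> k; exact: locally_constant_comp (lFij _ _).
by apply: eq_bigr => k _; rewrite mxE (meanZ I_mean).
Qed.

Lemma mxmean_mulmx p (A : 'M[R[i]]_(n, p)) :
  mxmean F *m A = mxmean (fun g => F g *m A).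
Proof.
apply/matrixP => i j; rewrite !mxE.
under [in RHS]eq_fun do rewrite mxE.
rewrite (mean_sum I_mean); last first.
  by move=> k; exact: (locally_constant_comp ( *%R^~ (A k j)) (lFij _ _)).
by apply: eq_bigr => k _; rewrite mxE (meanZr I_mean).
Qed.

Lemma mxmean_mulgl a : mxmean (fun g => F (a * g)%g) = mxmean F.
Proof. by apply/matrixP => i j; rewrite !mxE (mean_mulgl I_mean a (lFij i j)). Qed.

Lemma mxmean_precomp (alpha beta : G -> G) : continuous alpha ->
  (forall a h, a * alpha h = alpha (beta a * h))%g ->
  mxmean (fun g => F (alpha g)) = mxmean F.
Proof.
move=> ca ab; apply/matrixP => i j.
by rewrite !mxE (mean_precomp cG I_mean ca ab (lFij i j)).
Qed.

End MatrixMeanTheory.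

Lemma mxtrace_mxmean n (F : G -> 'M[R[i]]_n) : locally_constant F ->
  \tr (mxmean F) = I (fun g => \tr (F g)).
Proof.
move=> lF; rewrite /mxtrace (mean_sum I_mean); last first.
  by move=> i; exact: (locally_constant_comp (fun M : 'M[R[i]]_(_, _) => M i i)).
by apply: eq_bigr => i _; rewrite mxE.
Qed.

Lemma mxmean_cst m n (A : 'M[R[i]]_(m, n)) : mxmean (fun=> A) = A.
Proof.
by apply/matrixP => i j; rewrite mxE (mean_cst I_mean).
Qed.

End MatrixMean.

(** * Representations of profinite groups *)

Section Representations.
Variables (R : realType) (G : topologicalGroupType) (pG : profinite G).
Variables (I : (G -> R[i]) -> R[i]) (I_mean : invariant_mean I).

Let cG : compact [set: G]. Proof. by case: pG. Qed.

(** Reducible representations are included: the regular representation of a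
finite quotient, and its subrepresentations. *)
Definition smooth_representation n (rho : G -> 'M[R[i]]_n) : Prop :=
  [/\ rho 1%g = 1%:M, forall g h, rho (g * h)%g = rho g *m rho h
    & locally_constant rho].

Lemma irrep_smooth (r : irrep R G) : smooth_representation r.
Proof.
split; [exact: irrep1|exact: irrepM|].
apply: representation_locally_constant => //; [exact: irrep1|exact: irrepM|].
move=> i j x.
exact: (continuous_comp (@irrep_continuous _ _ r x) (@coord_continuous _ _ _ i j _)).
Qed.

Lemma irrep_locally_constant (r : irrep R G) : locally_constant r.
Proof. by have [] := irrep_smooth r. Qed.

Lemma irrep_char_locally_constant (r : irrep R G) : locally_constant (irrep_char r).
Proof. exact: locally_constant_comp (@irrep_locally_constant r). Qed.

Lemma irrepVK (r : irrep R G) g : r g^-1%g *m r g = 1%:M.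
Proof. by rewrite -irrepM mulVg irrep1. Qed.

Lemma irrep_deg_neq0 (r : irrep R G) : (irrep_deg r)%:R != 0 :> R[i].
Proof. by rewrite pnatr_eq0 -lt0n irrep_deg_gt0. Qed.

Lemma irrep_char1 (r : irrep R G) : irrep_char r 1%g = (irrep_deg r)%:R.
Proof. by rewrite /irrep_char irrep1 mxtrace1. Qed.

Lemma irrep_charJ (r : irrep R G) g x :
  irrep_char r (g * x * g^-1)%g = irrep_char r x.
Proof.
by rewrite /irrep_char !irrepM mxtrace_mulC mulmxA irrepVK mul1mx.
Qed.

(** * Schur's lemma and orthogonality *)

(** An eigenspace of an intertwiner is a nonzero submodule. *)
Lemma schur_scalar (r : irrep R G) M : (forall g, r g *m M = M *m r g) ->
  M = (\tr M / (irrep_deg r)%:R)%:M.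
Proof.
move=> rM.
have [a /eqP Ma] : exists a, kermx (M - a%:M) == 0 = false.
  have : size (char_poly M) != 1%N.
    by rewrite size_char_poly eqSS -lt0n irrep_deg_gt0.
  move=> /closed_rootP[a]; rewrite -eigenvalue_root_char => Ma.
  by exists a; apply/negbTE.
have [//|full] : kermx (M - a%:M) = 0 \/ row_full (kermx (M - a%:M)).
  apply: irrep_simple => g; apply/sub_kermxP.
  rewrite -mulmxA mulmxBr rM scalar_mxC -mulmxBl mulmxA.
  by rewrite mulmx_ker mul0mx.
have /eqP : M - a%:M = 0.
  have /sub_kermxP := submx_full 1%:M full.
  by rewrite mul1mx.
rewrite subr_eq0 => /eqP ->; congr (_%:M).
by rewrite mxtrace_scalar -[X in X / _]mulr_natr mulfK// irrep_deg_neq0.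
Qed.

(** The kernel and the image of an intertwiner are submodules. *)
Lemma schur_iso (r s : irrep R G) (M : 'M[R[i]]_(irrep_deg r, irrep_deg s)) :
  (forall g, r g *m M = M *m s g) -> M != 0 -> irrep_iso r s.
Proof.
move=> rMs M0; exists M => //; apply/andP; split.
  have [/eqP|full] : kermx M = 0 \/ row_full (kermx M).
  - apply: irrep_simple => g; apply/sub_kermxP.
    by rewrite -mulmxA rMs mulmxA mulmx_ker mul0mx.
  - by rewrite kermx_eq0.
  - have /sub_kermxP := submx_full 1%:M full.
    by rewrite mul1mx => M_0; rewrite M_0 eqxx in M0.
have [/eqP|full] : genmx M = 0 \/ row_full (genmx M).
- apply: irrep_simple => g.
  by rewrite (eqmxMr _ (genmxE M)) genmxE -rMs submxMl.
- by rewrite -mxrank_eq0 genmxE mxrank_eq0 (negbTE M0).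
- by move: full; rewrite -!sub1mx genmxE.
Qed.

Lemma irrep_iso_char (r s : irrep R G) : irrep_iso r s ->
  irrep_char r = irrep_char s.
Proof.
move=> [B /andP[Bfree Bfull] rBs]; apply/funext => g.
rewrite /irrep_char -[r g]mulmx1 -(mulmxVp Bfree) mulmxA rBs.
by rewrite mxtrace_mulC mulmxA mulVpmx// mul1mx.
Qed.

(** Averaging turns an arbitrary matrix into an intertwiner; applied to the
elementary matrices, this is the source of the orthogonality relations. *)
Definition average (r s : irrep R G) X :=
  mxmean I (fun h => r h *m X *m s h^-1%g).

Arguments average : clear implicits.

Lemma conjugates_locally_constant (r s : irrep R G) X :
  locally_constant (fun h => r h *m X *m s h^-1%g).
Proof.
apply: (locally_constant2 (fun A B => A *m X *m B)).
  exact: irrep_locally_constant.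
exact: locally_constant_invg (@irrep_locally_constant s).
Qed.

Arguments conjugates_locally_constant : clear implicits.

Local Notation lF := conjugates_locally_constant.

Lemma average_intertwines (r s : irrep R G) X g :
  r g *m average r s X = average r s X *m s g.
Proof.
rewrite /average -[in RHS](mxmean_mulgl I_mean (lF r s X) g).
have lFg : locally_constant (fun h => r (g * h)%g *m X *m s (g * h)^-1%g).
  exact: locally_constant_precomp (@continuous_mulgl _ g) (lF r s X).
rewrite (mulmx_mxmean I_mean (lF r s X)) (mxmean_mulmx I_mean lFg).
congr mxmean; apply/funext => h.
by rewrite !irrepM invgM irrepM -!mulmxA irrepVK mulmx1.
Qed.

(** The product of traces [\tr X * \tr Y] is the sum over i, j of the (i, j)
entries of [X *m delta_mx i j *m Y]. *)
Lemma convolution_char_average (r s : irrep R G) y :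
  I (fun h => irrep_char r h * irrep_char s (h^-1 * y)%g) =
  \sum_i \sum_j (average r s (delta_mx i j) *m s y) i j.
Proof.
have -> : (fun h => irrep_char r h * irrep_char s (h^-1 * y)%g) = fun h =>
    \sum_i \sum_j (r h *m delta_mx i j *m s h^-1%g *m s y) i j.
  apply/funext => h; rewrite /irrep_char irrepM /mxtrace mulr_suml.
  apply: eq_bigr => i _; rewrite mulr_sumr; apply: eq_bigr => j _.
  rewrite -mulmxA [RHS]mxE (bigD1 j)//= big1 => [|k kj].
    rewrite addr0; congr (_ * _); rewrite mxE (bigD1 i)//= big1 => [|l li].
      by rewrite mxE !eqxx mulr1 addr0.
    by rewrite mxE (negbTE li) mulr0.
  rewrite mxE big1 ?mul0r// => l _.
  by rewrite mxE (negbTE kj) andbF mulr0.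
have l i j : locally_constant
    (fun h => (r h *m delta_mx i j *m s h^-1%g *m s y) i j).
  exact: (locally_constant_comp
    (fun M : 'M[R[i]]_(_, _) => (M *m s y) i j) (lF r s (delta_mx i j))).
rewrite (mean_sum I_mean) => [|i]; last exact: locally_constant_sum.
apply: eq_bigr => i _; rewrite (mean_sum I_mean)//.
by apply: eq_bigr => j _; rewrite /average (mxmean_mulmx I_mean (lF _ _ _)) mxE.
Qed.

Lemma convolution_char_niso (r s : irrep R G) y : ~ irrep_iso r s ->
  I (fun h => irrep_char r h * irrep_char s (h^-1 * y)%g) = 0.
Proof.
move=> nrs; rewrite convolution_char_average big1// => i _; rewrite big1// => j _.
have -> : average r s (delta_mx i j) = 0.
  apply/eqP; apply: contraT => /schur_iso h; exfalso; apply: nrs; apply: h => g.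
  exact: average_intertwines.
by rewrite mul0mx mxE.
Qed.

Lemma convolution_char_idem (r : irrep R G) y :
  I (fun h => irrep_char r h * irrep_char r (h^-1 * y)%g) =
  irrep_char r y / (irrep_deg r)%:R.
Proof.
rewrite convolution_char_average.
have avgE i j : average r r (delta_mx i j) = ((i == j)%:R / (irrep_deg r)%:R)%:M.
  rewrite (schur_scalar (average_intertwines _)); congr (_ / _)%:M.
  rewrite (mxtrace_mxmean I_mean (lF _ _ _)).
  under eq_fun do rewrite mxtrace_mulC mulmxA irrepVK mul1mx.
  rewrite (mean_cst I_mean) /mxtrace (bigD1 i)//= big1 => [|k ki].
    by rewrite mxE eqxx addr0.
  by rewrite mxE (negbTE ki).
rewrite /irrep_char /mxtrace mulr_suml; apply: eq_bigr => i _.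
rewrite (bigD1 i)//= big1 => [|j ji].
  by rewrite avgE eqxx mul_scalar_mx mxE addr0 mul1r mulrC.
by rewrite avgE eq_sym (negbTE ji) mul0r mul_scalar_mx mxE mul0r.
Qed.

(** * The action of functions on representations *)

(** The operator by which [phi] acts on [rho], with the inverse placed so that
convolution of a character by [phi] on the right is a trace. *)
Definition transform n (phi : G -> R[i]) (rho : G -> 'M[R[i]]_n) : 'M[R[i]]_n :=
  mxmean I (fun h => phi h^-1%g *: rho h).

Section Transform.
Variables (phi : G -> R[i]) (lphi : locally_constant phi).

Let lphiV : locally_constant (fun h => phi h^-1%g).
Proof. exact: locally_constant_invg. Qed.

Let lT n (rho : G -> 'M[R[i]]_n) : locally_constant rho ->
  locally_constant (fun h => phi h^-1%g *: rho h).
Proof. by move=> lr; apply: (locally_constant2 (fun c A => c *: A)). Qed.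

Lemma convolution_char_transform (r : irrep R G) y :
  I (fun h => irrep_char r h * phi (h^-1 * y)%g) = \tr (r y *m transform phi r).
Proof.
have l := convolution_locally_constant y (@irrep_char_locally_constant r) lphi.
have lr := @irrep_locally_constant r.
rewrite -(mean_mulgl I_mean y l) (mulmx_mxmean I_mean (lT lr)).
rewrite (mxtrace_mxmean I_mean); last first.
  exact: (locally_constant_comp (fun M => r y *m M) (lT lr)).
congr I; apply/funext => h.
by rewrite -scalemxAr mxtraceZ mulrC invgM mulgVK /irrep_char irrepM.
Qed.

(** The mean is invariant under conjugation, so the operator of a class
function is an intertwiner and Schur's lemma applies. *)
Lemma transform_class (r : irrep R G) :
  (forall g x, phi (g * x * g^-1)%g = phi x) ->
  transform phi r = (\tr (transform phi r) / (irrep_deg r)%:R)%:M.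
Proof.
move=> cphi; apply: schur_scalar => g.
have lr := lT (@irrep_locally_constant r).
rewrite /transform -[in RHS](mxmean_precomp cG I_mean lr (@continuous_conjg _ g)
  (beta := fun a => (g^-1 * a * g)%g)); last by move=> a h; rewrite !mulgA mulgV mul1g.
rewrite (mulmx_mxmean I_mean lr) (mxmean_mulmx I_mean); last first.
  exact: locally_constant_precomp (@continuous_conjg _ g) lr.
congr mxmean; apply/funext => h; rewrite -scalemxAr -scalemxAl; congr (_ *: _).
  by rewrite !invgM invgK mulgA cphi.
by rewrite !irrepM -!mulmxA irrepVK mulmx1.
Qed.

(** Maschke's theorem: the average of the conjugates of any projection onto
[U] is an equivariant projection onto [U]. *)
Lemma equivariant_projection n (rho : G -> 'M[R[i]]_n) (U : 'M[R[i]]_n) :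
  smooth_representation rho -> (forall g, (U *m rho g <= U)%MS) ->
  exists P : 'M[R[i]]_n, [/\ forall g, rho g *m P = P *m rho g, (P <= U)%MS
    & U *m P = U].
Proof.
move=> [rho1 rhoM lrho] Uinv.
have [P0 P0U UP0] : exists2 P0 : 'M[R[i]]_n, (P0 <= U)%MS &
    forall X : 'M[R[i]]_n, (X <= U)%MS -> X *m P0 = X.
  exists (pinvmx U *m U); first exact: submxMl.
  by move=> X XU; rewrite mulmxA mulmxKpV.
pose F h := rho h *m P0 *m rho h^-1%g.
have lF0 : locally_constant F.
  by apply: (locally_constant2 (fun A B => A *m P0 *m B)) => //; exact: locally_constant_invg.
have rhoVK g : rho g^-1%g *m rho g = 1%:M by rewrite -rhoM mulVg.
have rhoKV g : rho g *m rho g^-1%g = 1%:M by rewrite -rhoM mulgV.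
exists (mxmean I F); split.
- move=> g; rewrite -[in RHS](mxmean_mulgl I_mean lF0 g).
  rewrite (mulmx_mxmean I_mean lF0) (mxmean_mulmx I_mean); last first.
    exact: locally_constant_precomp (@continuous_mulgl _ g) lF0.
  congr mxmean; apply/funext => h.
  by rewrite /F invgM !rhoM -!mulmxA rhoVK mulmx1.
- rewrite submxE (mxmean_mulmx I_mean lF0).
  rewrite (_ : (fun h => _) = fun=> 0); first by rewrite (mxmean_cst I_mean).
  apply/funext => h; apply/eqP; rewrite -submxE /F.
  by rewrite (submx_trans _ (Uinv h^-1%g))// submxMr// mulmx_sub.
- rewrite (mulmx_mxmean I_mean lF0) -[RHS](mxmean_cst I_mean).
  congr mxmean; apply/funext => h.
  by rewrite /F !mulmxA (UP0 (U *m rho h))// -mulmxA rhoKV mulmx1.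
Qed.

(** The restriction of [rho] to the row space of [U], written in a basis. *)
Lemma subrepresentation n (rho : G -> 'M[R[i]]_n) (U : 'M[R[i]]_n) :
  smooth_representation rho -> (forall g, (U *m rho g <= U)%MS) ->
  U *m transform phi rho != 0 ->
  exists2 sigma : G -> 'M[R[i]]_(\rank U), smooth_representation sigma &
    transform phi sigma != 0.
Proof.
move=> [rho1 rhoM lrho] Uinv UT0.
pose B := row_base U; have Bfree : row_free B by exact: row_base_free.
pose sigma g := B *m rho g *m pinvmx B.
have sigmaB g : sigma g *m B = B *m rho g.
  by rewrite mulmxKpV// (eqmxMr _ (eq_row_base U)) eq_row_base.
have lsigma : locally_constant sigma.
  exact: (locally_constant_comp (fun M => B *m M *m pinvmx B)).
exists sigma; first split=> //.
- by apply: (row_free_inj Bfree); rewrite sigmaB rho1 mulmx1 mul1mx.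
- move=> g h; apply: (row_free_inj Bfree).
  by rewrite sigmaB -[RHS]mulmxA sigmaB [RHS]mulmxA sigmaB rhoM mulmxA.
apply: contra UT0 => /eqP T0.
have BT : B *m transform phi rho = 0.
  transitivity (transform phi sigma *m B); last by rewrite T0 mul0mx.
  rewrite (mulmx_mxmean I_mean (lT lrho)) (mxmean_mulmx I_mean (lT lsigma)).
  by congr mxmean; apply/funext => h; rewrite -scalemxAr -scalemxAl sigmaB.
have /submxP[D ->] : (U <= B)%MS by rewrite eq_row_base.
by rewrite -mulmxA BT mulmx0.
Qed.

(** Induction on the degree: an equivariant projection [P] splits a reducible
[rho], and the operator of [phi] is nonzero on one of the two summands. *)
Lemma transform_irreducible n (rho : G -> 'M[R[i]]_n) :
  smooth_representation rho -> transform phi rho != 0 ->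
  exists r : irrep R G, transform phi r != 0.
Proof.
elim/ltn_ind: n rho => n IH rho srho T0.
have [rho1 rhoM lrho] := srho.
have n0 : (0 < n)%N.
  case: n {IH srho rho1 rhoM lrho} rho T0 => // rho.
  by rewrite flatmx0 eqxx.
have [simple|] := pselect (forall U : 'M[R[i]]_n,
    (forall g, (U *m rho g <= U)%MS) -> U = 0 \/ row_full U).
  have crho : continuous (rho : G -> 'M[R[i]^o]_n).
    exact: locally_constant_continuous.
  by exists (Irrep rho1 rhoM crho n0 simple).
move=> /existsNP[U /not_implyP[Uinv /not_orP[U0 Ufull]]].
have [P [rhoP PU UP]] := equivariant_projection srho Uinv.
have sub (V : 'M[R[i]]_n) : (forall g, (V *m rho g <= V)%MS) ->
    V *m transform phi rho != 0 -> ~~ row_full V ->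
    exists r : irrep R G, transform phi r != 0.
  move=> Vinv VT Vfull; have [sigma ssigma Ts] := subrepresentation srho Vinv VT.
  apply: (IH (\rank V)) Ts => //.
  by rewrite ltn_neqAle rank_leq_row andbT.
have [PT0|PT0] := eqVneq (P *m transform phi rho) 0; last first.
  apply: (sub P) => // [g|]; first by rewrite -rhoP submxMl.
  apply/negP => Pfull; apply: Ufull.
  by rewrite -sub1mx (submx_trans _ PU)// sub1mx.
apply: (sub (1%:M - P)).
- by move=> g; rewrite mulmxBl mul1mx -rhoP -[X in X - _]mulmx1 -mulmxBr submxMl.
- by rewrite mulmxBl PT0 mul1mx subr0.
- apply/negP => full; apply: U0.
  have : U *m (1%:M - P) = 0 by rewrite mulmxBr UP mulmx1 subrr.
  move: full; rewrite row_full_unit => /mulmxK K.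
  by move=> /(congr1 (mulmx^~ (invmx (1%:M - P)))); rewrite K mul0mx.
Qed.

(** A weak form of the Peter-Weyl theorem: [phi] factors through a finite
quotient, whose regular representation sends [phi] to a nonzero operator, and
this representation is a sum of irreducible ones. *)
Lemma irrep_detects x : phi x != 0 -> exists r : irrep R G, transform phi r != 0.
Proof.
move=> phix.
have oN := periods_open_subgroup cG lphi.
have [n [s [k kN]]] := finite_cosets cG oN; set N := periods phi in oN kN.
have [oN' N1 NB] := oN.
have k_mulN y u : N u -> k (y * u)%g = k y.
  move=> Nu; apply/kN; rewrite mulgA; apply: periodsM => //.
  exact/kN.
have k_s y h : k (s (k y) * h)%g = k (y * h)%g.
  have Nv : N ((s (k y))^-1 * y)%g by exact/kN.
  have := periodsJ h^-1%g Nv; rewrite invgK => /k_mulN <-.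
  by congr k; rewrite !mulgA mulgK mulgV mul1g.
(* the action by right translation on the cosets s i N *)
pose rho g : 'M[R[i]]_n := \matrix_(i, j) (k (s i * g)%g == j)%:R.
have srho : smooth_representation rho.
  split.
  - apply/matrixP => i j; rewrite !mxE mulg1; congr (nat_of_bool (_ == _))%:R.
    by apply/kN; rewrite mulVg; exact: N1.
  - move=> g h; apply/matrixP => i j; rewrite !mxE (bigD1 (k (s i * g)%g))//=.
    rewrite !mxE eqxx mul1r k_s mulgA big1 ?addr0// => l il.
    by rewrite !mxE eq_sym (negbTE il) mul0r.
  - apply: (locally_constant_right_invariant oN' N1) => g u Nu.
    by apply/matrixP => i j; rewrite !mxE mulgA (k_mulN _ u Nu).
apply: (transform_irreducible srho).
have [nv _] := mean_cosets I_mean oN kN; set v := I _ in nv.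
have v0 : v != 0 by apply/eqP => v0; move/eqP: nv; rewrite v0 mulr0 eq_sym oner_eq0.
pose i := k 1%g; pose j := k (s i * x^-1)%g.
apply/eqP => /matrixP/(_ i j); rewrite !mxE => Tij.
suff e : phi x * v = 0 by move/eqP: e; rewrite mulf_eq0 (negbTE phix) (negbTE v0).
rewrite -Tij.
have lN : locally_constant (fun x => `[< N x >]%:R : R[i]).
  exact: (locally_constant_comp (fun P => `[< P >]%:R)
    (open_subgroup_locally_constant oN)).
rewrite /v -(mean_mulgl I_mean ((s j)^-1 * s i)%g lN) -(meanZ I_mean); last first.
  exact: locally_constant_precomp (@continuous_mulgl _ _) lN.
congr I; apply/funext => h; rewrite !mxE -mulgA.
have [ij|ij] := eqVneq (k (s i * h)%g) j; last first.
  by rewrite asboolF ?mulr0// => /kN; exact/eqP.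
rewrite asboolT; last exact/kN.
congr (_ * _).
(* h and x^-1 lie in the same coset of N *)
have Nj : N ((s j)^-1 * s i * x^-1)%g by rewrite -mulgA; exact/kN.
have Nh : N ((s j)^-1 * s i * h)%g by rewrite -mulgA; exact/kN.
have := NB _ _ (periodsV Nh) (periodsV Nj).
rewrite invgK invgM -mulgA mulKg => /(_ 1%g x).
by rewrite !mul1g mulgVK.
Qed.
End Transform.
End Representations.

(** * Characters of a profinite abelian group *)

Section DualGroup.
Variables (R : realType) (A : topologicalZmodType) (pA : profinite A).

Local Notation Am := (GRing.to_multiplicative A).

Variables (I : (Am -> R[i]) -> R[i]) (I_mean : invariant_mean I).

Let cA : compact [set: Am]. Proof. by case: pA. Qed.

Lemma dual0 f : pontryagin_dual R A f -> f 0 = 1.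
Proof.
move=> [_ f_neq0 fD]; apply: (mulfI (f_neq0 0)).
by rewrite -fD addr0 mulr1.
Qed.

(** A character is a representation of degree 1. *)
Lemma dual_locally_constant f : pontryagin_dual R A f -> locally_constant (f : Am -> R[i]).
Proof.
move=> df; have [cf f_neq0 fD] := df.
pose rho (x : Am) : 'M[R[i]]_1 := (f x)%:M.
have lrho : locally_constant rho.
  apply: (@representation_locally_constant R Am 1 rho pA).
  - by rewrite /rho (dual0 df).
  - by move=> x y; rewrite /rho -scalar_mxM -fD.
  - move=> i j; rewrite !ord1 (_ : (fun g => _) = f)//.
    by apply/funext => x; rewrite mxE eqxx mulr1n.
move=> x; apply: filterS (lrho x) => y /matrixP/(_ 0 0).
by rewrite !mxE eqxx !mulr1n.
Qed.

Lemma convolution_dual_idem f y : pontryagin_dual R A f ->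
  I (fun h : Am => f h * f (h^-1 * y)%g) = f y.
Proof.
move=> [_ _ fD]; rewrite -[RHS](mean_cst I_mean); congr I; apply/funext => h.
by rewrite -fD; congr f; exact: (@mulVKg Am h y).
Qed.

(** Translating the integrand by [a] multiplies it by [f a / f' a]. *)
Lemma convolution_dual_neq f f' y : pontryagin_dual R A f ->
  pontryagin_dual R A f' -> f != f' -> I (fun h : Am => f h * f' (h^-1 * y)%g) = 0.
Proof.
move=> df df'; apply: contra_neqP => /eqP J0.
have [_ _ fD] := df; have [_ f'_neq0 f'D] := df'.
apply/funext => a; set J := I _ in J0.
have l : locally_constant (fun h : Am => f h * f' (h^-1 * y)%g) :=
  convolution_locally_constant y (dual_locally_constant df) (dual_locally_constant df').
have : J = (f a * f' (- a)) * J.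
  rewrite /J -(meanZ I_mean)// -[in LHS](mean_mulgl I_mean a l).
  congr I; apply/funext => h; rewrite mulrACA -fD -f'D; congr (_ * f' _).
  by rewrite invgM -mulgA; exact: (@addrCA A).
move=> /eqP; rewrite -[X in X == _]mul1r -subr_eq0 -mulrBl mulf_eq0 (negbTE J0) orbF.
rewrite subr_eq0 => /eqP e; apply: (mulIf (f'_neq0 (- a))).
by rewrite -e -f'D subrr (dual0 df').
Qed.

(** By Schur's lemma an irreducible representation of an abelian group acts by
scalars, which form a character. *)
Lemma dual_detects (phi : A -> R[i]) x : locally_constant phi -> phi x != 0 ->
  exists2 f, pontryagin_dual R A f & I (fun h : Am => phi h * f (- h)) != 0.
Proof.
move=> lphi phix.
have lphiV : locally_constant (fun h : Am => phi h^-1%g).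
  exact: locally_constant_invg.
have [t] : exists t : irrep R Am, transform I (fun h : Am => phi h^-1%g) t != 0.
  apply: (@irrep_detects R Am pA I I_mean _ lphiV (x : Am)^-1%g).
  by rewrite invgK.
pose a (h : Am) := \tr (t h) / (irrep_deg t)%:R.
have ta h : t h = (a h)%:M.
  apply: schur_scalar => g; rewrite -!irrepM; congr (t _).
  exact: (@addrC A).
have d0 := irrep_deg_neq0 t.
have scal_inj c c' : c%:M = c'%:M :> 'M[R[i]]_(irrep_deg t) -> c = c'.
  move=> /(congr1 (@mxtrace _ _)); rewrite !mxtrace_scalar.
  rewrite -[LHS]mulr_natr -[RHS]mulr_natr.
  exact: (mulIf d0).
have aD h h' : a (h * h')%g = a h * a h'.
  by apply: scal_inj; rewrite -ta irrepM !ta -scalar_mxM.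
have a1 : a 1%g = 1 by apply: scal_inj; rewrite -ta irrep1.
have la : locally_constant a.
  apply: (locally_constant_comp (fun M : 'M[R[i]]_(irrep_deg t) =>
    \tr M / (irrep_deg t)%:R)).
  exact: (@irrep_locally_constant R Am pA t).
move=> Tt; exists (fun h => a (- h)).
  split.
  - apply: (@locally_constant_continuous Am R[i]^o).
    exact: locally_constant_invg la.
  - move=> h; apply/eqP => ah; have /eqP := a1.
    by rewrite -(mulVg (- h : Am)) aD ah mulr0 eq_sym oner_eq0.
  - by move=> h h'; rewrite opprD; exact: aD.
apply: contra Tt => /eqP It; apply/eqP/matrixP => i j; rewrite !mxE.
rewrite (_ : (fun g => _) = fun h : Am => (phi h * a h) * (i == j)%:R); last first.
  by apply/funext => h; rewrite invgK ta !mxE mulr_natr mulrnAr.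
rewrite (meanZr I_mean); last exact: (locally_constant2 ( *%R)).
rewrite (_ : (fun _ => _) = fun h : Am => phi h * a (- - h)) ?It ?mul0r//.
by apply/funext => h; rewrite opprK.
Qed.

End DualGroup.

(** * Coadjoint orbits and their sums *)

Section OrbitMethod.
Variables (R : realType) (G : topologicalGroupType) (A : topologicalZmodType).
Variables (exp : A -> G) (log : G -> A).

Local Notation Am := (GRing.to_multiplicative A).

Variables (muG : probability (borel G) R) (muA : probability (borel Am) R).
Hypotheses (pG : profinite G) (pA : profinite A).
Hypotheses (haar_muG : haar muG) (haar_muA : haar muA).
Hypotheses (exp_continuous : continuous exp) (log_continuous : continuous log).
Hypotheses (expK : cancel exp log) (logK : cancel log exp).
Hypothesis AdD : forall g, {morph Ad exp log g : x y / x + y}.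
Hypothesis exp_convolution : forall f1 f2 : G -> R[i],
  class_Fun R G f1 -> class_Fun R G f2 ->
  convolution muG f1 f2 \o exp = convolution muA (f1 \o exp) (f2 \o exp).

Let cG : compact [set: G]. Proof. by case: pG. Qed.
Let cA : compact [set: Am]. Proof. by case: pA. Qed.
Let muG_mean := haar_invariant_mean cG haar_muG.
Let muA_mean := haar_invariant_mean cA haar_muA.

Local Notation Ad_ := (Ad exp log).
Local Notation orbit := (coadjoint_orbit exp log).
Local Notation dual := (pontryagin_dual R A).

Lemma AdM g h x : Ad_ (g * h)%g x = Ad_ g (Ad_ h x).
Proof. by rewrite /Ad logK invgM !mulgA. Qed.

Lemma Ad1 x : Ad_ 1%g x = x.
Proof. by rewrite /Ad invg1 mul1g mulg1 expK. Qed.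

Lemma AdVK g x : Ad_ g^-1%g (Ad_ g x) = x.
Proof. by rewrite -AdM mulVg Ad1. Qed.

Lemma AdKV g x : Ad_ g (Ad_ g^-1%g x) = x.
Proof. by rewrite -AdM mulgV Ad1. Qed.

Lemma Ad_log1 g : Ad_ g (log 1%g) = log 1%g.
Proof. by rewrite /Ad logK mulg1 mulgV. Qed.

Lemma Ad_continuous g : continuous (Ad_ g).
Proof.
apply: continuous_comp_fun log_continuous.
exact: continuous_comp_fun exp_continuous (@continuous_conjg _ g).
Qed.

Lemma coadjoint_dual g f : dual f -> dual (coadjoint exp log g f).
Proof.
move=> [cf f0 fD]; split.
- exact: (continuous_comp_fun (@Ad_continuous _) cf).
- by move=> x; exact: f0.
- by move=> x y; rewrite /coadjoint AdD fD.
Qed.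

Lemma orbit_dual f f' : dual f -> orbit f f' -> dual f'.
Proof. by move=> df [g _ <-]; exact: coadjoint_dual. Qed.

Lemma orbit_refl (f : A -> R[i]) : orbit f f.
Proof.
by exists 1%g => //; apply/funext => x; rewrite /coadjoint invg1 Ad1.
Qed.

Lemma orbit_eq (f f' : A -> R[i]) : orbit f f' -> orbit f' = orbit f.
Proof.
move=> [g _ <-]; apply/seteqP; split=> _ [h _ <-].
  exists (h * g)%g => //; apply/funext => x.
  by rewrite /coadjoint invgM AdM.
exists (h * g^-1)%g => //; apply/funext => x.
by rewrite /coadjoint invgM invgK AdM AdVK.
Qed.

Lemma orbit_finite f : dual f -> finite_set (orbit f).
Proof.
move=> df; apply: locally_constant_finite_range cG _.
apply: locally_constant_curry cA _.
apply: (locally_constant_precomp (h := fun p : G * A => Ad_ p.1^-1%g p.2))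
  (dual_locally_constant pA df).
apply: continuous_comp_fun log_continuous.
apply: continuous_mulg; last first.
  by apply: continuous_invg; apply: continuous_invg; exact: continuous_fst.
apply: continuous_mulg; first by apply: continuous_invg; exact: continuous_fst.
exact: continuous_comp_fun (@continuous_snd _ _) exp_continuous.
Qed.

Definition orbit_sum (Omega : set (A -> R[i])) (x : A) : R[i] :=
  \sum_(f \in Omega) f x.

Lemma orbit_sumE f x : dual f ->
  orbit_sum (orbit f) x = \sum_(f' <- fset_set (orbit f)) f' x.
Proof. by move=> df; rewrite /orbit_sum fsbig_finite//; exact: orbit_finite. Qed.

Local Notation tuple_of_orbit f := (in_tuple (fset_set (orbit f))).

Lemma orbit_sum_tuple f x : dual f ->
  orbit_sum (orbit f) x = \sum_i tnth (tuple_of_orbit f) i x.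
Proof. by move=> df; rewrite orbit_sumE// big_tnth. Qed.

Lemma tnth_orbit f i : dual f -> orbit f (tnth (tuple_of_orbit f) i).
Proof.
move=> df; have : tnth (tuple_of_orbit f) i \in fset_set (orbit f).
  exact: mem_tnth.
by rewrite in_fset_set ?inE//; exact: orbit_finite.
Qed.

Lemma tnth_orbit_locally_constant f i : dual f ->
  locally_constant (tnth (tuple_of_orbit f) i : Am -> R[i]).
Proof.
move=> df; apply: (dual_locally_constant pA).
exact: orbit_dual df (tnth_orbit i df).
Qed.

Lemma orbit_sum_locally_constant f : dual f ->
  locally_constant (orbit_sum (orbit f)).
Proof.
move=> df; have -> : orbit_sum (orbit f) =
    fun x => \sum_i tnth (tuple_of_orbit f) i x.
  by apply/funext => x; rewrite orbit_sum_tuple.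
apply: (@locally_constant_sum R Am) => i.
exact: tnth_orbit_locally_constant.
Qed.

Lemma orbit_sum_Ad f g x : dual f ->
  orbit_sum (orbit f) (Ad_ g x) = orbit_sum (orbit f) x.
Proof.
move=> df; rewrite /orbit_sum.
rewrite [LHS](reindex_fsbig (fun f' => coadjoint exp log g f') (orbit f))/=.
  by apply: eq_fsbigr => f' _; rewrite /coadjoint AdVK.
split.
- move=> f' off'; rewrite -(orbit_eq off').
  by exists g.
- move=> f1 f2 _ _ e; apply/funext => y.
  by have := congr1 (fun h => h (Ad_ g y)) e; rewrite /coadjoint AdVK.
- move=> f' off'; exists (coadjoint exp log g^-1%g f').
    by rewrite -(orbit_eq off'); exists g^-1%g.
  by apply/funext => y; rewrite /coadjoint invgK AdKV.
Qed.

Local Notation IA := (Cintegral muA).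
Local Notation IG := (Cintegral muG).

Lemma mean_Ad (F : A -> R[i]) g : locally_constant F ->
  IA (fun h : Am => F (Ad_ g h)) = IA F.
Proof.
move=> lF; apply: (@mean_precomp R Am IA (Ad_ g) (Ad_ g^-1%g)) => //.
- exact: Ad_continuous.
- by move=> a h; rewrite [RHS]AdD AdKV.
Qed.

(** The substitution [h |-> Ad g h] preserves the Haar mean. *)
Lemma fourier_orbit (phi : A -> R[i]) f f' : locally_constant phi ->
  (forall g x, phi (Ad_ g x) = phi x) -> dual f -> orbit f f' ->
  IA (fun h : Am => phi h * f' (- h)) = IA (fun h : Am => phi h * f (- h)).
Proof.
move=> lphi phiAd df [g _ <-].
have AdN h : Ad_ g^-1%g (- h) = - Ad_ g^-1%g h.
  have Ad0 : Ad_ g^-1%g 0 = 0.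
    by apply: (addrI (Ad_ g^-1%g 0)); rewrite -AdD !addr0.
  by apply/eqP; rewrite -addr_eq0 -AdD addNr Ad0.
rewrite -(@mean_Ad (fun h => phi h * f (- h)) g^-1%g); last first.
  apply: (locally_constant2 ( *%R)) => //.
  exact: (@locally_constant_invg Am _ f (dual_locally_constant pA df)).
by congr Cintegral; apply/funext => h; rewrite phiAd /coadjoint AdN.
Qed.

(** On A, convolution by an Ad-invariant function multiplies each character by
its Fourier coefficient, and that coefficient is constant on orbits. *)
Lemma convolution_orbit_sum (phi : A -> R[i]) f y : locally_constant phi ->
  (forall g x, phi (Ad_ g x) = phi x) -> dual f ->
  convolution muA phi (orbit_sum (orbit f)) y =
  IA (fun h : Am => phi h * f (- h)) * orbit_sum (orbit f) y.
Proof.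
move=> lphi phiAd df; rewrite /convolution.
have l i : locally_constant (fun h : Am => phi h * tnth (tuple_of_orbit f) i (- h)).
  apply: (locally_constant2 ( *%R)) => //.
  exact: (@locally_constant_invg Am _ _ (tnth_orbit_locally_constant i df)).
transitivity (IA (fun h : Am =>
    \sum_i tnth (tuple_of_orbit f) i y * (phi h * tnth (tuple_of_orbit f) i (- h)))).
  congr Cintegral; apply/funext => h; rewrite orbit_sum_tuple// mulr_sumr.
  apply: eq_bigr => i _; rewrite mulrCA; congr (_ * _).
  have [_ _ tD] := orbit_dual df (tnth_orbit i df).
  by rewrite mulrC -tD.
rewrite (mean_sum muA_mean); last first.
  by move=> i; exact: (locally_constant_comp ( *%R _) (l i)).
rewrite orbit_sum_tuple// mulr_sumr; apply: eq_bigr => i _.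
rewrite (meanZ muA_mean)// mulrC; congr (_ * _).
exact: fourier_orbit (tnth_orbit i df).
Qed.

(** The orthogonality relations of characters, summed over an orbit. *)
Lemma fourier_orbit_sum f f' : dual f -> dual f' ->
  IA (fun h : Am => orbit_sum (orbit f) h * f' (- h)) = `[< orbit f f' >]%:R.
Proof.
move=> df df'.
have ti i := orbit_dual df (tnth_orbit i df).
have l i : locally_constant (fun h : Am => tnth (tuple_of_orbit f) i h * f' (- h)).
  apply: (locally_constant2 ( *%R)); first exact: tnth_orbit_locally_constant.
  exact: (@locally_constant_invg Am _ _ (dual_locally_constant pA df')).
transitivity (\sum_i IA (fun h : Am => tnth (tuple_of_orbit f) i h * f' (- h))).
  rewrite -(mean_sum muA_mean)//; congr Cintegral; apply/funext => h.
  by rewrite orbit_sum_tuple// mulr_suml.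
have e (t : A -> R[i]) : IA (fun h : Am => t h * f' (- h)) =
    IA (fun h : Am => t h * f' (h^-1 * (0%R : Am))%g).
  by congr Cintegral; apply/funext => h; congr (_ * f' _); rewrite -[LHS]addr0.
transitivity (\sum_i (tnth (tuple_of_orbit f) i == f')%:R : R[i]).
  apply: eq_bigr => i _; rewrite e.
  have [->|neq] := eqVneq; last exact: (convolution_dual_neq pA muA_mean _ (ti i) df').
  by rewrite (convolution_dual_idem muA_mean _ df') (dual0 df').
rewrite -(big_tnth _ _ (fset_set (orbit f)) xpredT (fun t => (t == f')%:R)).
rewrite -natr_sum; congr _%:R.
transitivity (count_mem f' (fset_set (orbit f))).
  by rewrite -sum1_count [RHS]big_mkcond; apply: eq_bigr => t _ /=; case: eqP.
by rewrite count_uniq_mem ?fset_uniq// in_fset_set//; exact: orbit_finite.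
Qed.

Lemma orbit_sum_neq0 f : dual f -> exists x, orbit_sum (orbit f) x != 0.
Proof.
move=> df; apply: contrapT => /forallNP e0.
have := fourier_orbit_sum df df; rewrite asboolT; last exact: orbit_refl.
rewrite (_ : (fun h => _) = fun=> 0).
  by rewrite (mean_cst muA_mean) => /eqP; rewrite eq_sym oner_eq0.
apply/funext => h; have /negP := e0 h; rewrite negbK => /eqP ->.
by rewrite mul0r.
Qed.

Lemma orbit_sum_inj f f' : dual f -> dual f' ->
  orbit_sum (orbit f) = orbit_sum (orbit f') -> orbit f = orbit f'.
Proof.
move=> df df' e; apply/esym/orbit_eq; apply: contrapT => noff'.
have := fourier_orbit_sum df' df'; rewrite -e fourier_orbit_sum//.
rewrite asboolF// asboolT; last exact: orbit_refl.
by move=> /eqP; rewrite eq_sym oner_eq0.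
Qed.

(** * Matching minimal idempotents *)

(** The minimal idempotent of the convolution algebra of class functions that
belongs to [r]; [orbit_sum] gives those of the algebra of Ad-invariant
functions on A. *)
Definition char_idempotent (r : irrep R G) (g : G) : R[i] :=
  (irrep_deg r)%:R * irrep_char r g.

Lemma char_idempotent_locally_constant r : locally_constant (char_idempotent r).
Proof.
exact: (locally_constant_comp ( *%R _) (irrep_char_locally_constant pG r)).
Qed.

Lemma char_idempotent_class r : class_Fun R G (char_idempotent r).
Proof.
split; last by move=> g x; rewrite /= /char_idempotent irrep_charJ.
exact: (locally_constant_Fun cG (char_idempotent_locally_constant r)).
Qed.

Lemma orbit_sum_log_locally_constant f : dual f ->
  locally_constant (orbit_sum (orbit f) \o log).
Proof.
move=> df.
exact: (locally_constant_precomp log_continuous (orbit_sum_locally_constant df)).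
Qed.

Lemma orbit_sum_logJ f g x : dual f ->
  orbit_sum (orbit f) (log (g * x * g^-1)%g) = orbit_sum (orbit f) (log x).
Proof. by move=> df; rewrite -[in LHS](logK x); exact: orbit_sum_Ad. Qed.

Lemma orbit_sum_class f : dual f -> class_Fun R G (orbit_sum (orbit f) \o log).
Proof.
move=> df; split; last by move=> g x; exact: orbit_sum_logJ.
exact: (locally_constant_Fun cG (orbit_sum_log_locally_constant df)).
Qed.

Lemma char_idempotent_exp_locally_constant r :
  locally_constant (char_idempotent r \o exp).
Proof.
exact: (locally_constant_precomp exp_continuous (@char_idempotent_locally_constant r)).
Qed.

Lemma char_idempotent_exp_Ad r g x :
  char_idempotent r (exp (Ad_ g x)) = char_idempotent r (exp x).
Proof. by rewrite /Ad logK /char_idempotent irrep_charJ. Qed.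

Lemma char_idempotent_exp_log1 r :
  char_idempotent r (exp (log 1%g)) = (irrep_deg r)%:R ^+ 2.
Proof. by rewrite logK /char_idempotent irrep_char1 expr2. Qed.

Lemma char_idempotent_neq0 r : char_idempotent r (exp (log 1%g)) != 0.
Proof. by rewrite char_idempotent_exp_log1 expf_neq0// irrep_deg_neq0. Qed.

Lemma char_idempotent_idem r :
  convolution muG (char_idempotent r) (char_idempotent r) = char_idempotent r.
Proof.
apply/funext => y; rewrite /convolution /char_idempotent.
have lr := irrep_char_locally_constant pG r.
have l := convolution_locally_constant y lr lr.
under eq_fun do rewrite mulrACA.
rewrite (meanZ muG_mean)// (convolution_char_idem pG muG_mean).
by rewrite -mulrA; congr (_ * _); rewrite mulrCA mulfV ?mulr1// irrep_deg_neq0.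
Qed.

Lemma convolution_char_orbit r f y : dual f ->
  convolution muG (char_idempotent r) (orbit_sum (orbit f) \o log) y =
  \tr (transform IG (orbit_sum (orbit f) \o log) r) / (irrep_deg r)%:R
    * char_idempotent r y.
Proof.
move=> df; rewrite /convolution /char_idempotent.
have l := convolution_locally_constant y (irrep_char_locally_constant pG r)
  (orbit_sum_log_locally_constant df).
under eq_fun do rewrite -mulrA.
rewrite (meanZ muG_mean)//.
rewrite (convolution_char_transform pG muG_mean (orbit_sum_log_locally_constant df)).
rewrite [in LHS](transform_class pG muG_mean (orbit_sum_log_locally_constant df)); last first.
  by move=> g x; exact: orbit_sum_logJ.
by rewrite mul_mx_scalar mxtraceZ mulrCA.
Qed.

(** The product of the two idempotents, computed on G and on A, is a multiple
[c'] of one and a multiple [c] of the other. *)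
Section Match.
Variables (r : irrep R G) (f : A -> R[i]) (df : dual f).

Let phi := char_idempotent r \o exp.
Let e := orbit_sum (orbit f).
Let c := IA (fun h : Am => phi h * f (- h)).
Let c' := \tr (transform IG (e \o log) r) / (irrep_deg r)%:R.

Let scalars y : c' * phi y = c * e y.
Proof.
rewrite -(convolution_orbit_sum y _ _ df); last 2 first.
- exact: char_idempotent_exp_locally_constant.
- exact: char_idempotent_exp_Ad.
have -> : orbit_sum (orbit f) = (e \o log) \o exp.
  by apply/funext => x; rewrite /= expK.
rewrite -exp_convolution; [|exact: char_idempotent_class|exact: orbit_sum_class].
by rewrite /= convolution_char_orbit.
Qed.

Let c'_neq0 : c != 0 -> c' != 0.
Proof.
move=> c0; have [x ex] := orbit_sum_neq0 df.
apply: contra_neq ex => c'0; apply: (mulfI c0).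
by rewrite -scalars c'0 mul0r mulr0.
Qed.

Let c_neq0 : c' != 0 -> c != 0.
Proof.
move=> c'0; apply: contra_neq (char_idempotent_neq0 r) => c0.
by apply: (mulfI c'0); rewrite scalars c0 mul0r mulr0.
Qed.

(** If the product is nonzero, the two functions are proportional; being
idempotents, they are equal. *)
Lemma char_idempotent_orbit_sum : (c != 0) || (c' != 0) -> phi = e.
Proof.
move=> cc'.
have c0 : c != 0 by case/orP: cc' => //; exact: c_neq0.
have c'0 := c'_neq0 c0.
pose k := c / c'.
have phiE y : phi y = k * e y.
  by apply: (mulfI c'0); rewrite scalars /k mulrA mulrCA mulfV// mulr1.
have le : locally_constant e := orbit_sum_locally_constant df.
have kc : c = k.
  rewrite /c; under eq_fun do rewrite phiE -mulrA.
  rewrite (meanZ muA_mean); last first.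
    apply: (locally_constant2 ( *%R)) => //.
    exact: (@locally_constant_invg Am _ f (dual_locally_constant pA df)).
  by rewrite fourier_orbit_sum// asboolT ?mulr1//; exact: orbit_refl.
have phiI y : convolution muA phi phi y = phi y.
  rewrite -exp_convolution; try exact: char_idempotent_class.
  by rewrite char_idempotent_idem.
have : convolution muA phi phi (log 1%g) = c * phi (log 1%g).
  rewrite [X in _ = c * X]phiE /convolution.
  rewrite mulrCA -(convolution_orbit_sum _ _ _ df); last 2 first.
  - exact: char_idempotent_exp_locally_constant.
  - exact: char_idempotent_exp_Ad.
  rewrite -(meanZ muA_mean); last first.
    exact: (@convolution_locally_constant Am _ _ _ (log 1%g)
      (@char_idempotent_exp_locally_constant r) le).
  by congr Cintegral; apply/funext => h; rewrite [X in _ * X]phiE mulrCA.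
rewrite phiI => /eqP; rewrite -[X in X == _]mul1r -subr_eq0 -mulrBl mulf_eq0.
rewrite (negbTE (char_idempotent_neq0 r)) orbF subr_eq0 => /eqP c1.
by apply/funext => y; rewrite phiE -kc -c1 mul1r.
Qed.

End Match.

(** Some character occurs in the Fourier expansion of the idempotent of [r]. *)
Lemma orbit_of_irrep r : exists2 f, dual f &
  char_idempotent r \o exp = orbit_sum (orbit f).
Proof.
have [f df c0] := dual_detects pA muA_mean (x := log 1%g)
  (@char_idempotent_exp_locally_constant r) (char_idempotent_neq0 r).
by exists f => //; apply: char_idempotent_orbit_sum => //; rewrite c0.
Qed.

(** Some irreducible representation detects the orbit sum, read on G. *)
Lemma irrep_of_orbit f : dual f -> exists r : irrep R G,
  char_idempotent r \o exp = orbit_sum (orbit f).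
Proof.
move=> df; have [x ex] := orbit_sum_neq0 df.
have le := orbit_sum_log_locally_constant df.
have [r Tr] : exists r : irrep R G,
    transform IG (orbit_sum (orbit f) \o log) r != 0.
  by apply: (irrep_detects pG muG_mean le (x := exp x)); rewrite /= expK.
exists r; apply: char_idempotent_orbit_sum => //; apply/orP; right.
apply: contra_neq Tr => c'0.
rewrite (transform_class pG muG_mean le) ?c'0 ?raddf0//.
by move=> g y; exact: orbit_sum_logJ.
Qed.

(** Idempotents of non-isomorphic representations are orthogonal. *)
Lemma irrep_isoP (r s : irrep R G) :
  irrep_iso r s <-> char_idempotent r = char_idempotent s.
Proof.
split=> [rs|ers].
  have chi := irrep_iso_char rs.
  by apply/funext => g; rewrite /char_idempotent -!irrep_char1 chi.
apply: contrapT => nrs; move/eqP: (char_idempotent_neq0 r); apply.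
rewrite -[in LHS]char_idempotent_idem [X in convolution _ _ X]ers /convolution.
rewrite /char_idempotent; under eq_fun do rewrite mulrACA.
rewrite (meanZ muG_mean) ?(convolution_char_niso pG muG_mean _ nrs) ?mulr0//.
exact: (convolution_locally_constant _ (irrep_char_locally_constant pG r)
  (irrep_char_locally_constant pG s)).
Qed.

(** Two of the values [f (x *+ m) = f x ^+ m] coincide, the range of [f] being
finite, so [f x] is a root of unity. *)
Lemma dual_norm f x : dual f -> `|f x| = 1.
Proof.
move=> df; have [_ f_neq0 fD] := df.
have fX m : f (x *+ m) = f x ^+ m.
  by elim: m => [|m IH]; rewrite ?(dual0 df)// mulrS fD IH exprS.
have [n [s [k [fsk _ _]]]] :=
  locally_constant_fibres cA (dual_locally_constant pA df).
have : ~~ injectiveb (fun m : 'I_n.+1 => k (x *+ m)).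
  apply/negP => /injectiveP/leq_card.
  by rewrite !card_ord ltnn.
move=> /injectivePn[a [b ab kab]].
wlog lt_ab : a b ab kab / (a < b)%N.
  move=> h; case: (ltngtP a b) => [|ba|/val_inj eab]; first exact: h.
    by apply: (h b a) => //; rewrite eq_sym.
  by rewrite eab eqxx in ab.
have : f x ^+ b = f x ^+ a by rewrite -!fX -fsk -kab fsk.
rewrite -(subnK (ltnW lt_ab)) exprD -[RHS]mul1r => /(mulIf (expf_neq0 _ (f_neq0 x))).
move=> /(congr1 Num.norm); rewrite normrX normr1 => /eqP.
by rewrite pexpr_eq1 ?subn_gt0// => /eqP.
Qed.

(** Evaluate at [log 1], which is fixed by Ad: every character in the orbit
takes there the same value, of modulus 1. Taking norms removes this value, since
the other side is positive. *)
Lemma card_orbit f r : dual f -> char_idempotent r \o exp = orbit_sum (orbit f) ->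
  #|` fset_set (orbit f)| = (irrep_deg r ^ 2)%N.
Proof.
move=> df /(congr1 (fun F => F (log 1%g))).
rewrite /= char_idempotent_exp_log1 orbit_sumE// big_seq.
rewrite (eq_bigr (fun=> f (log 1%g))) => [|f']; last first.
  rewrite in_fset_set ?inE; last exact: orbit_finite.
  by move=> [g _ <-]; rewrite /coadjoint Ad_log1.
rewrite -big_seq big_const_seq count_predT iter_addr_0.
move=> /(congr1 Num.norm); rewrite normrX normr_nat normrMn dual_norm// -natrX.
by move=> /eqP; rewrite eqr_nat => /eqP.
Qed.

Lemma orbit_correspondence :
  (forall Omega, dual_orbits R exp log Omega -> finite_set Omega) /\
  exists2 Phi : set (A -> R[i]) -> set (irrep R G),
    set_bij (dual_orbits R exp log) (irrep_classes R G) Phi &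
    forall (Omega : set (A -> R[i])) (r : irrep R G),
      dual_orbits R exp log Omega -> Phi Omega r ->
      forall x : A, irrep_char r (exp x) =
        ((Num.sqrt (#|` fset_set Omega|%:R : R))^-1)%:C *
        \sum_(f \in Omega) f x.
Proof.
split; first by move=> _ [f df <-]; exact: orbit_finite.
pose Phi (Omega : set (A -> R[i])) : set (irrep R G) :=
  [set s | char_idempotent s \o exp = orbit_sum Omega].
have PhiE f r : char_idempotent r \o exp = orbit_sum (orbit f) ->
    Phi (orbit f) = [set s | irrep_iso r s].
  move=> rf; apply/seteqP; split=> s; rewrite /Phi/=; last by move=> /irrep_isoP <-.
  move=> sf; apply/irrep_isoP/funext => g.
  by have := congr1 (fun F => F (log g)) (etrans rf (esym sf)); rewrite /= logK.
exists Phi; first split.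
- move=> _ [f df <-]; have [r rf] := irrep_of_orbit df.
  by exists r => //; rewrite (PhiE f r rf).
- move=> _ _ /set_mem[f df <-] /set_mem[f' df' <-] PhiP.
  have [r rf] := irrep_of_orbit df.
  have rf' : Phi (orbit f') r by rewrite -PhiP.
  by apply: orbit_sum_inj => //; rewrite -rf.
- move=> _ [r _ <-]; have [f df rf] := orbit_of_irrep r.
  by exists (orbit f); [exists f|exact: PhiE].
move=> _ r [f df <-] rf x; rewrite (card_orbit df rf) natrX sqrtr_sqr normr_nat.
have -> : \sum_(f' \in orbit f) f' x = char_idempotent r (exp x).
  by have := congr1 (fun F => F x) rf.
by rewrite fmorphV rmorph_nat /char_idempotent mulKf// irrep_deg_neq0.
Qed.

End OrbitMethod.

Theorem theorem1p1 (R : realType) (G : topologicalGroupType)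
    (A : topologicalZmodType) (exp : A -> G) (log : G -> A)
    (muG : probability (borel G) R)
    (muA : probability (borel (GRing.to_multiplicative A)) R)
    (profinite_G : profinite G) (profinite_A : profinite A)
    (haar_muG : haar muG) (haar_muA : haar muA)
    (exp_continuous : continuous exp) (log_continuous : continuous log)
    (expK : cancel exp log) (logK : cancel log exp)
    (Ad_aut : forall g : G,
       {morph Ad exp log g : x y / x + y} /\ bijective (Ad exp log g))
    (exp_convolution : forall f1 f2 : G -> R[i],
       class_Fun R G f1 -> class_Fun R G f2 ->
       convolution muG f1 f2 \o exp =
       convolution muA (f1 \o exp) (f2 \o exp)) :
  (forall Omega, dual_orbits R exp log Omega -> finite_set Omega) /\
  exists2 Phi : set (A -> R[i]) -> set (irrep R G),
    set_bij (dual_orbits R exp log) (irrep_classes R G) Phi &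
    forall (Omega : set (A -> R[i])) (r : irrep R G),
      dual_orbits R exp log Omega -> Phi Omega r ->
      forall x : A, irrep_char r (exp x) =
        ((Num.sqrt (#|` fset_set Omega|%:R : R))^-1)%:C *
        \sum_(f \in Omega) f x.
Proof.
exact: (orbit_correspondence profinite_G profinite_A haar_muG haar_muA
  exp_continuous log_continuous expK logK (fun g => (Ad_aut g).1)
  exp_convolution).
Qed.
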